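(* Let $\mathcal W$ be a measure matrix and let $\boldsymbol L_\alpha=\sum_{n,r}a^{(\alpha)}_{n,r}x^n\frac{d^r}{dx^r}$, $\alpha=1,2$, be linear differential operators with polynomial coefficients. Put $L_\alpha:=\sum_{n,r}a^{(\alpha)}_{n,r}D^r\Lambda^n$ and $\mathcal L_\alpha:=\sum_{n,r}a^{(\alpha)}_{n,r}(\Lambda^\top)^r\mathcal X^n$. Then $$(\boldsymbol L_1[f],\boldsymbol L_2[h];\mathcal W)=(f,h;\mathcal L_1\mathcal W\mathcal L_2^\top)$$ (for all polynomials $f,h$, and more generally whenever both sides are defined), and $$L_1G_{\mathcal W}(L_2)^\top=G_{\mathcal L_1\mathcal W(\mathcal L_2)^\top}.$$
   Context: Semi-infinite matrices are indexed from $0$. A measure matrix is a semi-infinite matrix $\mathcal W=(d\mu_{i,j})$ of (possibly signed) Borel measures on sets $\Omega_{i,j}\subseteq\mathbb R$, zero for $i$ or $j$ larger than some order $\mathcal N$ (the case $\mathcal N\to\infty$ being allowed, since only finitely many terms contribute on polynomials); $(f,h;\mathcal W)=\sum_{n,r}\int_{\Omega_{n,r}}f^{(n)}h^{(r)}d\mu_{n,r}$, finite on polynomials; $(G_{\mathcal W})_{n,p}=(x^n,x^p;\mathcal W)$. Products of a matrix with polynomial entries in $x$ and $\mathcal W$ are formed entrywise (polynomial times measure). $\Lambda_{i,j}=\delta_{i+1,j}$ is the shift and $D$ is the derivation matrix $D_{i,j}=i\,\delta_{i-1,j}$, so that with $\chi(x)=(1,x,x^2,\dots)^\top$ one has $\Lambda\chi=x\chi$,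 $D\chi=\chi'$. $\mathcal X$ is the upper bidiagonal matrix with $\mathcal X_{n,n}=x$, $\mathcal X_{n,n+1}=n+1$, all other entries zero.
   Formalization: ''Whenever both sides are defined'' means: finite order N, derivatives up to N plus the operator's order exist on an open set containing all Ω_{i,j} and all integrals converge absolutely; infinite order (literal claim false), f,h smooth there and the fully expanded right side converges absolutely. *)

(* Defs.v *)
From HB Require Import structures.
From mathcomp Require Import all_boot all_order all_algebra.
From mathcomp Require Import all_classical all_reals all_analysis.

Set Implicit Arguments.
Unset Strict Implicit.
Unset Printing Implicit Defensive.

Import Order.TTheory GRing.Theory Num.Theory.
Import numFieldNormedType.Exports.

Local Open Scope classical_set_scope.
Local Open Scope ring_scope.

(* Semi-infinite matrices, indexed from 0.  Products are finitely supported
   sums: they are the usual products as soon as the rows of the left factor, or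
   the columns of the right factor, are finite. *)

Definition smx (T : Type) := nat -> nat -> T.

Definition smx_tr (T : Type) (A : smx T) : smx T := fun i j => A j i.

Definition smx_mul (T : comNzRingType) (A B : smx T) : smx T :=
  fun i j => \sum_(k \in [set: nat]) (A i k * B k j).

Definition smx_exp (T : comNzRingType) (A : smx T) (n : nat) : smx T :=
  iter n (smx_mul A) (fun i j => (i == j)%:R).

Definition smx_shift (T : comNzRingType) : smx T := fun i j => (j == i.+1)%:R.

(* [j == i.-1] also holds at [i = j = 0], where the factor [i] vanishes. *)
Definition smx_deriv (T : comNzRingType) : smx T :=
  fun i j => i%:R * (j == i.-1)%:R.

Definition smx_X (R : realType) : smx {poly R} :=
  fun n m => if m == n then 'X else if m == n.+1 then n.+1%:R else 0.

(* A linear differential operator \sum_(n, r) a_(n, r) x^n d^r/dx^r with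
   polynomial coefficients is encoded as a polynomial in d/dx whose coefficients
   are polynomials in x: a_(n, r) is [a`_r`_n], and the order of the operator is
   [(size a).-1]. *)

Definition ldo (R : realType) := {poly {poly R}}.

Definition ldo_order (R : realType) (a : ldo R) : nat := (size a).-1.

Definition ldo_app (R : realType) (a : ldo R) (f : R -> R) : R -> R :=
  fun x => \sum_(r < size a) \sum_(n < size a`_r)
    a`_r`_n * x ^+ n * derive1n r f x.

Definition ldo_mx (R : realType) (a : ldo R) : smx R :=
  fun i j => \sum_(r < size a) \sum_(n < size a`_r)
    a`_r`_n * smx_mul (smx_exp (@smx_deriv R) r) (smx_exp (@smx_shift R) n) i j.

Definition ldo_pmx (R : realType) (a : ldo R) : smx {poly R} :=
  fun i j => \sum_(r < size a) \sum_(n < size a`_r)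
    (a`_r`_n)%:P *
    smx_mul (smx_exp (smx_tr (@smx_shift {poly R})) r) (smx_exp (@smx_X R) n) i j.

(* Signed Borel measures are charges on the Borel sets of the line.  Integrals
   with respect to a charge are taken through its Jordan decomposition; by
   uniqueness of the latter they do not depend on the choice of the Hahn
   decomposition. *)

Definition bcharge (R : realType) :=
  {charge set (measurableTypeR R) -> \bar R}.

Section charge_integral.
Context {R : realType}.
Implicit Types (nu : bcharge R) (D : set R) (f : R -> R).

Definition hahn_pos nu : set R := projT1 (cid (Hahn_decomposition nu)).

Definition hahn_neg nu : set R :=
  projT1 (cid (projT2 (cid (Hahn_decomposition nu)))).

Definition hahnP nu : hahn_decomposition nu (hahn_pos nu) (hahn_neg nu) :=
  projT2 (cid (projT2 (cid (Hahn_decomposition nu)))).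

Definition cpos nu : {measure set (measurableTypeR R) -> \bar R} :=
  jordan_pos (hahnP nu).

Definition cneg nu : {measure set (measurableTypeR R) -> \bar R} :=
  jordan_neg (hahnP nu).

Definition cvariation nu : {measure set (measurableTypeR R) -> \bar R} :=
  charge_variation (hahnP nu).

Definition cintegrable nu D f : Prop :=
  (cvariation nu).-integrable D (EFin \o f).

Definition cintegral nu D f : R :=
  \int[cpos nu]_(x in D) f x - \int[cneg nu]_(x in D) f x.

(* The charge [f nu], that is [A |-> \int_A f dnu].  The default branch is never
   reached on a polynomial times an entry of a measure matrix. *)
Definition cdensity f nu : bcharge R :=
  match pselect ((cpos nu).-integrable [set: R] (EFin \o f)),
        pselect ((cneg nu).-integrable [set: R] (EFin \o f)) with
  | left fpos, left fneg => cadd (induced_charge fpos)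
                                 (copp (induced_charge fneg))
  | _, _ => czero
  end.

End charge_integral.

(* A matrix of charges together with the sets that carry its entries: a measure
   on [\Omega_(i, j)] is encoded by its extension by zero to the line. *)

Record charge_matrix (R : realType) := ChargeMatrix {
  cm_dom : nat -> nat -> set R ;
  cm_charge :> nat -> nat -> bcharge R }.

Section sobolev_form.
Context {R : realType}.
Implicit Types (W : charge_matrix R) (f h : R -> R) (U : set R).

Definition term_integrable W f h (n r : nat) : Prop :=
  cintegrable (W n r) (cm_dom W n r) (fun x => derive1n n f x * derive1n r h x).

Definition term_integral W f h (n r : nat) : R :=
  cintegral (W n r) (cm_dom W n r) (fun x => derive1n n f x * derive1n r h x).

(* The bilinear form (f, h; W).  The partial sums are eventually constant when f
   and h are polynomials, and when W has finite order. *)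
Definition sform W f h : R :=
  limn (fun m => \sum_(n < m) \sum_(r < m) term_integral W f h n r).

Definition is_measure_matrix W : Prop :=
  [/\ forall i j, measurable (cm_dom W i j : set (measurableTypeR R)),
      forall i j (A : set (measurableTypeR R)), measurable A ->
        A `<=` ~` cm_dom W i j -> W i j A = 0%E
    & forall (p q : {poly R}) n r, term_integrable W (horner p) (horner q) n r].

Definition has_order W (N : nat) : Prop :=
  forall i j (A : set (measurableTypeR R)), measurable A ->
    (N < i)%N \/ (N < j)%N -> W i j A = 0%E.

Definition gram W : smx R :=
  fun n p => sform W (fun x => x ^+ n) (fun x => x ^+ p).

(* The triple product [P W Q]: the (i, j) entry is the sum over k, l of the
   charges P_(i, k) Q_(l, j) dmu_(k, l), where k ranges over the (finite) support
   of the i-th row of P and l over that of the j-th column of Q. *)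
Definition pmx_mul (P : smx {poly R}) W (Q : smx {poly R}) : charge_matrix R :=
  ChargeMatrix
    (fun i j => \bigcup_(kl in [set kl : nat * nat |
                   P i kl.1 != 0 /\ Q kl.2 j != 0]) cm_dom W kl.1 kl.2)
    (fun i j =>
      \big[(@cadd _ _ _ : bcharge R -> bcharge R -> bcharge R)/
           (czero : bcharge R)]_(k <- finite_support 0 [set: nat] (P i))
      \big[(@cadd _ _ _ : bcharge R -> bcharge R -> bcharge R)/
           (czero : bcharge R)]_(l <- finite_support 0 [set: nat] (Q ^~ j))
        cdensity (horner (P i k * Q l j)) (W k l)).

Definition derivable_upto U (n : nat) f : Prop :=
  forall k, (k < n)%N -> forall x, U x -> derivable (derive1n k f) x 1.

(* For W of order at most max(m, n): the derivatives occurring in (f, h; W)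
   exist and all its terms are absolutely convergent integrals. *)
Definition sform_defined U W (m n : nat) f h : Prop :=
  [/\ derivable_upto U m f, derivable_upto U n h
    & forall i j, (i <= m)%N -> (j <= n)%N -> term_integrable W f h i j].

(* Absolute convergence of (f, h; P W Q) once all its entries are expanded.
   For a measure matrix of infinite order, convergence of the two unexpanded
   double series does not imply that their sums agree: take
   W_(k, 0) = (-1)^k / k! \delta_1 (and 0 elsewhere), the operators x and 1, h = 1
   and f smooth, equal to 1/x near 1.  Then (x f, 1; W) = 1, but the first
   column of the product vanishes, hence (f, 1; P W Q) = 0. *)
Definition expanded_summable (P : smx {poly R}) W (Q : smx {poly R}) f h : Prop :=
  (\esum_(q in [set: (nat * nat) * (nat * nat)])
     \int[cvariation (W q.2.1 q.2.2)]_(x in cm_dom W q.2.1 q.2.2)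
       `| derive1n q.1.1 f x * derive1n q.1.2 h x *
          (P q.1.1 q.2.1).[x] * (Q q.2.2 q.1.2).[x] |%:E < +oo)%E.

End sobolev_form.

(* Main.v *)
Require Import Defs.
From HB Require Import structures.
From mathcomp Require Import all_boot all_order all_algebra.
From mathcomp Require Import all_classical all_reals all_analysis.
From mathcomp Require Import measurable_realfun ring lra zify.

(**
  Let [P = ldo_pmx a1] and [Q = (ldo_pmx a2)^T]. The heart of the matter is that
  [P] is the matrix of the operator acting on jets: for a smooth enough [f],
  the [k]-th derivative of [L_1 f] is the sum over [i] of [f^(i) P_(i, k)]
  (lemma [derive1n_ldo_app]). This holds because the columns of [P] satisfy the
  recursion [P_(i, k+1) = (P_(i, k))' + P_(i-1, k)] imposed by the product rule
  (lemma [ldo_pmx_col]), while column [0] lists the coefficients of [L_1].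

  Both sides then expand into the same quadruple sum of the integrals of
  [f^(i) h^(j) P_(i, k) Q_(l, j)] against the charges [W_(k, l)], grouped by
  [(k, l)] on the left ([cintegral_ldo_app]) and by [(i, j)] on the right
  ([cintegral_pmx_mul]). The second grouping rests on the additivity of the
  integral in the charge and on the formula for the integral against a density.
  Integrals against a charge are defined through its Jordan decomposition, which
  does not commute with these operations; [cintegral_diff] removes the obstacle
  by showing that any decomposition into a difference of finite measures may be
  used instead.

  It remains to justify the interchange of sums.
  - In infinite order, absolute convergence of the quadruple sum is assumed, and
    the two forms are limits of its partial sums over two exhaustions of the
    index set ([summable_box_cvg]).
  - For polynomials all but finitely many terms vanish, so that this is a special
    case.
  - In finite order the sums are finite, but only the grouped integrals are known
    to converge, not the individual terms. The domain of integration is therefore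
    truncated to the sets on which all the products [f^(i) h^(j)] are bounded, and
    the truncated identities pass to the limit by dominated convergence.

  The identity of Gram matrices is the polynomial case on monomials, since row
  [i] of [ldo_mx a] consists of the coefficients of the image of [x^i]
  ([coef_ldo_polyXn]).
*)

Set Implicit Arguments.
Unset Strict Implicit.
Unset Printing Implicit Defensive.

Import Order.TTheory GRing.Theory Num.Theory.
Import numFieldNormedType.Exports.

Local Open Scope classical_set_scope.
Local Open Scope ring_scope.

(** * Finite sums and semi-infinite matrices *)

Lemma sum_ord_trunc (V : nmodType) (n m : nat) (F : nat -> V) : (n <= m)%N ->
  (forall i, (n <= i)%N -> F i = 0) -> \sum_(i < m) F i = \sum_(i < n) F i.
Proof.
move=> nm F0; rewrite [RHS](big_ord_widen m F nm) [RHS]big_mkcond/=.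
by apply: eq_bigr => i _; case: ltnP => // /F0.
Qed.

Lemma exchange_sum4 (V : nmodType) (a b c d : nat) (F : nat -> nat -> nat -> nat -> V) :
  \sum_(i < a) \sum_(j < b) \sum_(k < c) \sum_(l < d) F i j k l =
  \sum_(k < c) \sum_(l < d) \sum_(i < a) \sum_(j < b) F i j k l.
Proof.
under eq_bigr do rewrite exchange_big/=.
rewrite exchange_big/=; apply: eq_bigr => k _.
under eq_bigr do rewrite exchange_big/=.
by rewrite exchange_big.
Qed.

Section semi_infinite_matrices.
Context {T : comNzRingType}.

Lemma fsum_nat (n : nat) (F : nat -> T) :
  (forall k, (n <= k)%N -> F k = 0) ->
  \sum_(k \in [set: nat]) F k = \sum_(k < n) F k.
Proof.
move=> F0; rewrite (fsbig_ord +%R n F); apply/esym/fsbig_widen => // k [_ /= /negP].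
by rewrite -leqNgt => /F0.
Qed.

Lemma fsum_nat1 (n : nat) (F : nat -> T) :
  (forall k, k != n -> F k = 0) -> \sum_(k \in [set: nat]) F k = F n.
Proof.
move=> F0; rewrite (@fsum_nat n.+1); last by move=> k nk; rewrite F0// gtn_eqF.
by rewrite big_ord_recr/= big1 ?add0r// => i _; rewrite F0// ltn_eqF.
Qed.

Lemma smx_expS (A : smx T) n : smx_exp A n.+1 = smx_mul A (smx_exp A n).
Proof. by []. Qed.

Lemma smx_mul_shift_tr (B : smx T) i j :
  smx_mul (smx_tr (@smx_shift T)) B i j = if i is i'.+1 then B i' j else 0.
Proof.
rewrite /smx_mul /smx_tr /smx_shift; case: i => [|i].
  by rewrite fsbig1// => k _; rewrite mul0r.
rewrite (@fsum_nat1 i) ?eqxx ?mul1r// => k ki.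
by rewrite eqSS eq_sym (negbTE ki) mul0r.
Qed.

Lemma smx_exp_shift_tr r i j :
  smx_exp (smx_tr (@smx_shift T)) r i j = (i == j + r)%N%:R.
Proof.
elim: r i => [|r IH] i; first by rewrite addn0.
rewrite smx_expS smx_mul_shift_tr; case: i => [|i]; rewrite addnS// IH.
Qed.

Lemma smx_mul_exp_shift_tr r (B : smx T) i j :
  smx_mul (smx_exp (smx_tr (@smx_shift T)) r) B i j =
  if (r <= i)%N then B (i - r)%N j else 0.
Proof.
rewrite /smx_mul; case: ifPn => [ri|]; last first.
  rewrite -ltnNge => ir; rewrite fsbig1// => k _.
  by rewrite smx_exp_shift_tr ltn_eqF ?mul0r// ltn_addl.
rewrite (@fsum_nat1 (i - r)%N); first by rewrite smx_exp_shift_tr subnK// eqxx mul1r.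
move=> k; rewrite smx_exp_shift_tr -{2}(subnK ri) eqn_add2r eq_sym => /negbTE ->.
by rewrite mul0r.
Qed.

Lemma smx_exp_shift n i j : smx_exp (@smx_shift T) n i j = (j == i + n)%N%:R.
Proof.
elim: n i => [|n IH] i; first by rewrite addn0 eq_sym.
rewrite smx_expS /smx_mul (@fsum_nat1 i.+1) /smx_shift ?eqxx ?mul1r ?IH ?addSnnS//.
by move=> k /negbTE ->; rewrite mul0r.
Qed.

Lemma smx_exp_deriv r i j :
  smx_exp (@smx_deriv T) r i j = (i ^_ r)%:R * (j == i - r)%N%:R.
Proof.
elim: r i => [|r IH] i; first by rewrite ffactn0 mul1r subn0 eq_sym.
rewrite smx_expS /smx_mul (@fsum_nat1 i.-1) /smx_deriv; last first.
  by move=> k /negbTE ->; rewrite mulr0 mul0r.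
by rewrite eqxx mulr1 IH mulrA -natrM ffactnS -predn_sub -subnS.
Qed.

Lemma smx_mul_exp_deriv_shift r n i j :
  smx_mul (smx_exp (@smx_deriv T) r) (smx_exp (@smx_shift T) n) i j =
  (i ^_ r)%:R * (j == i - r + n)%N%:R.
Proof.
rewrite /smx_mul (@fsum_nat1 (i - r)%N).
  by rewrite smx_exp_deriv smx_exp_shift eqxx mulr1.
by move=> k /negbTE kn; rewrite smx_exp_deriv kn mulr0 mul0r.
Qed.

End semi_infinite_matrices.

Section powers_of_X.
Context {R : realType}.
Local Notation Xexp n := (smx_exp (@smx_X R) n).

Lemma smx_exp_XS n s k :
  Xexp n.+1 s k = 'X * Xexp n s k + s.+1%:R * Xexp n s.+1 k.
Proof.
rewrite smx_expS {1}/smx_mul (@fsum_nat _ s.+2); last first.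
  move=> l sl; rewrite /smx_X gtn_eqF ?gtn_eqF ?mul0r//; exact: ltnW.
rewrite !big_ord_recr/= big1 ?add0r.
  by rewrite /smx_X !eqxx gtn_eqF.
by move=> [l/= ls] _; rewrite /smx_X !ltn_eqF ?mul0r// ltnW.
Qed.

Lemma smx_exp_X_lower n s k : (k < s)%N -> Xexp n s k = 0.
Proof.
elim: n s => [|n IH] s ks; first by rewrite /= gtn_eqF.
by rewrite smx_exp_XS !IH ?mulr0 ?addr0// ltnW.
Qed.

Lemma smx_exp_X_upper n s k : (s + n < k)%N -> Xexp n s k = 0.
Proof.
elim: n s => [|n IH] s sk; first by rewrite /= ltn_eqF// -[s]addn0.
rewrite smx_exp_XS !IH ?mulr0 ?addr0// ?addSnnS//.
by rewrite (leq_ltn_trans _ sk)// leq_add2l.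
Qed.

Lemma smx_exp_X_diag0 n : Xexp n 0%N 0%N = 'X^n.
Proof.
elim: n => [|n IH]; first by rewrite expr0.
by rewrite smx_exp_XS IH smx_exp_X_lower// mulr0 addr0 exprS.
Qed.

(** The entry [(s, k)] of [X^n] is the coefficient of [f^(s)] in the [k]-th
    derivative of [x^n f]; differentiating once more is the product rule. *)
Lemma smx_exp_X_col n s k :
  Xexp n s k.+1 = (Xexp n s k)^`() + if s is s'.+1 then Xexp n s' k else 0.
Proof.
elim: n s => [|n IH] s.
  by case: s => [|s]; rewrite /= derivMn derivC mul0rn add0r ?eqSS.
rewrite !smx_exp_XS !IH derivD !derivM derivX derivMn derivC mul0rn mul0r add0r.
case: s => [|s]; first by ring.
by rewrite smx_exp_XS -[in s.+2%:R]natr1; ring.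
Qed.

End powers_of_X.

(** * The matrix of an operator acting on jets *)

Section operator_matrix.
Context {R : realType}.
Implicit Types (a : ldo R).

(** Above the diagonal, [ldo_pmx a] has at most this many nonzero bands, since
    each factor [X] adds one. *)
Definition ldo_deg a : nat := \max_(r < size a) size (a`_r)%R.

Lemma ldo_pmxE a i j : ldo_pmx a i j =
  \sum_(r < size a) \sum_(n < size a`_r)
    (a`_r`_n)%:P * if (r <= i)%N then smx_exp (@smx_X R) n (i - r)%N j else 0.
Proof.
by do 2![apply: eq_bigr => ? _]; rewrite smx_mul_exp_shift_tr.
Qed.

Lemma ldo_pmx_upper a i k : (i + ldo_deg a < k)%N -> ldo_pmx a i k = 0.
Proof.
move=> ik; rewrite ldo_pmxE big1// => r _; rewrite big1// => n _.
case: ifPn => ri; rewrite ?mulr0// smx_exp_X_upper ?mulr0//.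
rewrite (leq_ltn_trans _ ik)// leq_add ?leq_subr// ltnW//.
apply: (leq_trans (ltn_ord n)); exact: (leq_bigmax (F := fun r : 'I_(size a) => size (a`_r)%R)).
Qed.

Lemma ldo_pmx_tr_upper a l j :
  (j + ldo_deg a < l)%N -> smx_tr (ldo_pmx a) l j = 0.
Proof. exact: ldo_pmx_upper. Qed.

Lemma ldo_pmx_lower a i k : (k + ldo_order a < i)%N -> ldo_pmx a i k = 0.
Proof.
move=> ki; rewrite ldo_pmxE big1// => r _; rewrite big1// => n _.
case: ifPn => ri; rewrite ?mulr0// smx_exp_X_lower ?mulr0//.
have := ltn_ord r; move: ki; rewrite /ldo_order; lia.
Qed.

Lemma ldo_pmx_col0 a i : ldo_pmx a i 0%N = a`_i.
Proof.
rewrite ldo_pmxE; have [ia|ai] := ltnP i (size a); last first.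
  rewrite nth_default// big1// => r _; rewrite big1// => n _.
  rewrite ltnW ?(leq_trans (ltn_ord r))// smx_exp_X_lower ?mulr0//.
  by rewrite subn_gt0 (leq_trans (ltn_ord r)).
rewrite (bigD1 (Ordinal ia))//= leqnn subnn [X in _ + X]big1 ?addr0.
  under eq_bigr do rewrite smx_exp_X_diag0 mul_polyC.
  by rewrite -poly_def coefK.
move=> r; rewrite -val_eqE/= => ri; rewrite big1// => n _.
case: ifPn => ler; rewrite ?mulr0// smx_exp_X_lower ?mulr0//.
by rewrite subn_gt0 ltn_neqAle ri.
Qed.

(** With [ldo_pmx_col0] this determines [ldo_pmx a]. It says that the columns
    are the coefficients of [f^(i)] in the successive derivatives of the operator
    applied to [f]. *)
Lemma ldo_pmx_col a i k : ldo_pmx a i k.+1 =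
  (ldo_pmx a i k)^`() + if i is i'.+1 then ldo_pmx a i' k else 0.
Proof.
have -> : (if i is i'.+1 then ldo_pmx a i' k else 0) =
    \sum_(r < size a) \sum_(n < size a`_r) (a`_r`_n)%:P *
      if i is i'.+1 then
        if (r <= i')%N then smx_exp (@smx_X R) n (i' - r)%N k else 0
      else 0.
  case: i => [|i]; last by rewrite ldo_pmxE.
  by rewrite big1// => r _; rewrite big1// => n _; rewrite mulr0.
rewrite !ldo_pmxE raddf_sum -big_split/=; apply: eq_bigr => r _.
rewrite raddf_sum -big_split/=; apply: eq_bigr => n _.
rewrite derivM derivC mul0r add0r -mulrDr; congr (_ * _).
case: ifPn => [ri|]; last first.
  rewrite -ltnNge deriv0 add0r; case: i => // i ir.
  by rewrite leqNgt (ltn_trans _ ir).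
rewrite smx_exp_X_col; congr (_ + _).
case: i ri => [|i]; first by rewrite sub0n.
move: (nat_of_ord r) (nat_of_ord n) => {}r {}n.
rewrite leq_eqVlt => /predU1P[->|]; first by rewrite subnn ltnn.
by rewrite ltnS => ri; rewrite ri subSn.
Qed.

End operator_matrix.

Section operator_on_functions.
Context {R : realType}.
Implicit Types (a : ldo R) (f : R -> R) (U : set R).

Lemma ldo_appE a f x :
  ldo_app a f x = \sum_(r < size a) derive1n r f x * (a`_r).[x].
Proof.
apply: eq_bigr => r _; rewrite -mulr_suml mulrC; congr (_ * _).
by rewrite [in RHS]horner_coef.
Qed.

(** By induction on [k]: the product rule acts on the coefficients as
    [ldo_pmx_col]. Openness of [U] allows the formula for [k] to be
    differentiated, as it holds near every point of [U]. *)
Lemma derive1n_ldo_app a U f k : open U -> derivable_upto U (k + ldo_order a) f ->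
  forall x, U x -> derive1n k (ldo_app a f) x =
    \sum_(i < (k + ldo_order a).+1) derive1n i f x * (ldo_pmx a i k).[x].
Proof.
move=> oU; elim: k => [|k IH] df x Ux.
  rewrite derive1n0 ldo_appE (big_ord_widen _ (fun r => derive1n r f x * (a`_r).[x]) (leqSpred _)).
  rewrite big_mkcond/=; apply: eq_bigr => i _; rewrite ldo_pmx_col0.
  by case: ltnP => // ai; rewrite nth_default// horner0 mulr0.
have {}IH := IH (fun k' kk' => df k' (ltnW kk')).
rewrite derive1nS derive1E.
(* Differentiating [f^(i) P_(i, k)] gives [f^(i) P_(i, k)' + f^(i.+1) P_(i, k)]. *)
set K := (k + ldo_order a)%N in df IH *.
pose g i : R -> R := derive1n i f * horner (ldo_pmx a i k).
have -> : 'D_1 (derive1n k (ldo_app a f)) x = 'D_1 (\sum_(i < K.+1) g i) x.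
  apply: near_eq_derive; near=> y; rewrite IH ?fct_sumE//.
  by near: y; exact: open_nbhs_nbhs.
have dg i : (i < K.+1)%N -> derivable (derive1n i f) x 1 by move=> iK; exact: df.
rewrite derive_sum; last first.
  move=> i; apply: derivableM; first exact: dg.
  exact: derivable_horner.
transitivity (\sum_(i < K.+1) (derive1n i f x * (ldo_pmx a i k)^`().[x] +
                               derive1n i.+1 f x * (ldo_pmx a i k).[x])).
  apply: eq_bigr => i _; rewrite deriveM; [|exact: dg|exact: derivable_horner].
  by rewrite -!derive1E -derive1nS -derivE; congr (_ + _); rewrite mulrC.
rewrite big_split/=; under [RHS]eq_bigr do rewrite ldo_pmx_col hornerD mulrDr.
rewrite big_split/=; congr (_ + _).
  rewrite [RHS]big_ord_recr/= ldo_pmx_lower ?deriv0 ?horner0 ?mulr0 ?addr0//.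
by rewrite [RHS]big_ord_recl/= horner0 mulr0 add0r.
Unshelve. all: by end_near. Qed.

End operator_on_functions.

(** * The matrix of an operator acting on monomials *)

Section operator_on_polynomials.
Context {R : realType}.
Implicit Types (a : ldo R) (p : {poly R}).

Lemma derive1n_horner n p : derive1n n (horner p) = horner p^`(n).
Proof. by elim: n => // n IH; rewrite derive1nS IH -derivE derivnS. Qed.

Lemma derivable_upto_horner (U : set R) n p : derivable_upto U n (horner p).
Proof. by move=> k _ x _; rewrite derive1n_horner; exact: derivable_horner. Qed.

Definition ldo_poly a p : {poly R} := \sum_(r < size a) p^`(r) * a`_r.

Lemma ldo_app_horner a p : ldo_app a (horner p) = horner (ldo_poly a p).
Proof.
apply/funext => x; rewrite ldo_appE horner_sum; apply: eq_bigr => r _.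
by rewrite derive1n_horner hornerM.
Qed.

(** The identity [L chi = L[chi]] between the matrix and the operator: row [i]
    of [ldo_mx a] lists the coefficients of the image of [x^i]. *)
Lemma coef_ldo_polyXn a i j : (ldo_poly a 'X^i)`_j = ldo_mx a i j.
Proof.
rewrite coef_sum; apply: eq_bigr => r _.
rewrite -[X in _ * X]coefK poly_def mulr_sumr coef_sum; apply: eq_bigr => n _.
rewrite smx_mul_exp_deriv_shift derivnXn -scalerAr coefZ; congr (_ * _).
by rewrite mulr_natl [_ *+ _ * _]mulrnAl -exprD coefMn coefXn.
Qed.

End operator_on_polynomials.

(** * Integration against a charge *)

Section integrable_measures.
Context d (T : measurableType d) (R : realType).
Variables (m1 m2 : {measure set T -> \bar R}).
Implicit Types (D : set T) (f : T -> \bar R).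

Lemma le_integrable_measure D f :
  measurable D -> (forall A, measurable A -> (m1 A <= m2 A)%E) ->
  m2.-integrable D f -> m1.-integrable D f.
Proof.
move=> mD m12 /integrableP[mf fi]; apply/integrableP; split => //.
apply: le_lt_trans fi; rewrite integral_mkcond [leRHS]integral_mkcond.
apply: ge0_le_measure_integral => //.
  by move=> x; rewrite patchE; case: ifP.
by apply: (measurable_restrictT _ mD).1; exact: measurableT_comp.
Qed.

Lemma integrable_measure_add D f :
  measurable D -> m1.-integrable D f -> m2.-integrable D f ->
  (measure_add m1 m2).-integrable D f.
Proof.
move=> mD /integrableP[mf f1] /integrableP[_ f2]; apply/integrableP; split => //.
rewrite ge0_integral_measure_add//; first exact: lte_add_pinfty.
exact: measurableT_comp.
Qed.

End integrable_measures.

Lemma fin_num_crossD (R : realType) (p n a b : \bar R) :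
  p \is a fin_num -> n \is a fin_num -> a \is a fin_num -> b \is a fin_num ->
  (p - n = a - b)%E -> (p + b = n + a)%E.
Proof. by case: p n a b => [p||] [n||] [a||] [b||]//= _ _ _ _ [?]; congr EFin; lra. Qed.

Section charge_integral_theory.
Context {R : realType}.
Local Notation T := (measurableTypeR R).
Implicit Types (nu : bcharge R) (D A : set T) (f g : T -> R).
Implicit Types (m : {measure set T -> \bar R}).

(** The Jordan parts again, with their finiteness recorded in the type, as the
    Radon-Nikodym theorem requires. *)
Definition fcpos nu : {finite_measure set T -> \bar R} := jordan_pos (hahnP nu).
Definition fcneg nu : {finite_measure set T -> \bar R} := jordan_neg (hahnP nu).

Lemma hahn_posP nu : measurable (hahn_pos nu : set T).
Proof. by have [[]] := hahnP nu. Qed.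

Lemma hahn_negP nu : measurable (hahn_neg nu : set T).
Proof. by have [_ []] := hahnP nu. Qed.

Lemma cposE nu A : measurable A -> cpos nu A = nu (A `&` hahn_pos nu).
Proof.
move=> mA; rewrite -[LHS]/(jordan_pos (hahnP nu) A).
by rewrite jordan_posE cjordan_posE /crestr0 mem_set.
Qed.

Lemma cnegE nu A : measurable A -> cneg nu A = (- nu (A `&` hahn_neg nu))%E.
Proof.
by move=> mA; rewrite -[LHS]/(jordan_neg (hahnP nu) A) jordan_negE cjordan_negE /crestr0 mem_set.
Qed.

Lemma charge_jordanE nu A : measurable A -> nu A = (cpos nu A - cneg nu A)%E.
Proof. by move=> mA; rewrite (jordan_decomp (hahnP nu) mA) /cadd/= cscaleN1. Qed.

Lemma cvariationE nu A : cvariation nu A = (cpos nu A + cneg nu A)%E.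
Proof. by []. Qed.

Lemma cintegrableP nu D f : measurable D ->
  cintegrable nu D f <->
  (cpos nu).-integrable D (EFin \o f) /\ (cneg nu).-integrable D (EFin \o f).
Proof.
move=> mD; split => [fi|[f1 f2]].
  by split; apply: le_integrable_measure fi => // A mA;
    rewrite cvariationE ?leeDl ?leeDr.
apply: le_integrable_measure (integrable_measure_add mD f1 f2) => // A mA.
by rewrite -[leRHS]/(measure_add (cpos nu) (cneg nu) A) measure_addE.
Qed.

(** Any writing of a charge as a difference of finite measures computes its
    integrals: the Jordan parts are the smallest such pair, so integrability is
    inherited, and the two sums of crossed measures coincide. *)
Lemma cintegral_diff nu m1 m2 D f : measurable D ->
  fin_num_fun m1 -> fin_num_fun m2 ->
  (forall A, measurable A -> nu A = m1 A - m2 A)%E ->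
  m1.-integrable D (EFin \o f) -> m2.-integrable D (EFin \o f) ->
  cintegrable nu D f /\
  cintegral nu D f = \int[m1]_(x in D) f x - \int[m2]_(x in D) f x.
Proof.
move=> mD fin1 fin2 nuE f1 f2.
have pos1 A : measurable A -> (cpos nu A <= m1 A)%E.
  move=> mA; have mAP := measurableI _ _ mA (hahn_posP nu).
  rewrite cposE// nuE// (@le_trans _ _ (m1 (A `&` hahn_pos nu)))//.
    by rewrite leeBlDr ?fin1 ?fin2// leeDl.
  by rewrite le_measure ?inE.
have neg2 A : measurable A -> (cneg nu A <= m2 A)%E.
  move=> mA; have mAP := measurableI _ _ mA (hahn_negP nu).
  rewrite cnegE// nuE// (@le_trans _ _ (m2 (A `&` hahn_neg nu)))//.
    by rewrite fin_num_oppeB ?fin1 ?fin2// addeC leeBlDr ?fin1 ?fin2// leeDl.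
  by rewrite le_measure ?inE.
have fp := le_integrable_measure mD pos1 f1.
have fn := le_integrable_measure mD neg2 f2.
split; first exact/cintegrableP.
have mf := measurable_int _ f1.
have E : (\int[cpos nu]_(x in D) (f x)%:E + \int[m2]_(x in D) (f x)%:E =
          \int[cneg nu]_(x in D) (f x)%:E + \int[m1]_(x in D) (f x)%:E)%E.
  rewrite -!integral_measure_add//; apply: eq_measure_integral => A mA _.
  rewrite -[LHS]/(measure_add (cpos nu) m2 A) -[RHS]/(measure_add (cneg nu) m1 A).
  rewrite !measure_addE; apply: fin_num_crossD; rewrite ?fin1 ?fin2 ?fin_num_measure//.
  by rewrite -charge_jordanE// nuE.
move: E; rewrite /cintegral /Rintegral.
have := integrable_fin_num mD f1; have := integrable_fin_num mD f2.
have := integrable_fin_num mD fp; have := integrable_fin_num mD fn.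
do 4![case: (\int[_]_(x in D) _)%E => [?||]//= _].
by move=> [abcd]; lra.
Qed.

End charge_integral_theory.

(** * Measures with a density *)

Section density.
Context d (T : measurableType d) (R : realType).
Variable mu : {finite_measure set T -> \bar R}.
Variable w : T -> R.
Hypotheses (w0 : forall x, 0 <= w x) (iw : mu.-integrable [set: T] (EFin \o w)).

Let density_ge0 A : (0 <= induced_charge iw A)%E.
Proof. by apply: integral_ge0 => x _; rewrite lee_fin. Qed.

Definition density_measure : set T -> \bar R := measure_of_charge _ density_ge0.

HB.instance Definition _ := Measure.on density_measure.

Let density_fin : fin_num_fun density_measure.
Proof. by move=> A mA; exact: (@fin_num_measure _ _ _ (induced_charge iw)). Qed.

HB.instance Definition _ :=
  @Measure_isFinite.Build _ _ _ density_measure density_fin.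

Lemma density_measureE A : density_measure A = (\int[mu]_(x in A) (w x)%:E)%E.
Proof. by []. Qed.

Lemma density_measure_dominates : density_measure `<< mu.
Proof.
apply/null_content_dominatesP => A mA A0.
rewrite density_measureE null_set_integral//.
by apply: measurable_funTS; exact: measurable_int iw.
Qed.

Let RN := Radon_Nikodym_SigmaFinite.f density_measure mu.

(** The change of variables below is the one for Radon-Nikodym derivatives, as
    [w] is the derivative of its own density measure. *)
Lemma ae_eq_density D : measurable D -> ae_eq mu D RN (EFin \o w).
Proof.
move=> mD; apply: integral_ae_eq => //.
- apply: (integrableS measurableT) => //.
  exact/Radon_Nikodym_SigmaFinite.f_integrable/density_measure_dominates.
- by apply: measurable_funTS; exact: measurable_int iw.
- move=> A AD mA; rewrite -Radon_Nikodym_SigmaFinite.f_integral//.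
  exact: density_measure_dominates.
Qed.

Lemma ge0_integral_density D (f : T -> \bar R) : measurable D ->
  measurable_fun D f -> (forall x, 0 <= f x)%E ->
  (\int[density_measure]_(x in D) f x = \int[mu]_(x in D) (f x * (w x)%:E))%E.
Proof.
move=> mD mf f0.
rewrite -(Radon_Nikodym_SigmaFinite.change_of_variables density_measure_dominates)//.
apply: ae_eq_integral => //.
- apply: emeasurable_funM => //; apply: measurable_funTS; apply: measurable_int.
  exact/Radon_Nikodym_SigmaFinite.f_integrable/density_measure_dominates.
- by apply: emeasurable_funM => //; apply: measurable_funTS; exact: measurable_int iw.
- exact/ae_eqe_mul2l/ae_eq_density.
Qed.

Lemma integrable_density D (f : T -> R) : measurable D -> measurable_fun D f ->
  mu.-integrable D (fun x => (f x * w x)%:E) ->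
  density_measure.-integrable D (EFin \o f).
Proof.
move=> mD mf /integrableP[_ fw]; apply/integrableP; split.
  exact/measurable_EFinP.
rewrite ge0_integral_density//; last by apply: measurableT_comp => //; exact/measurable_EFinP.
apply: le_lt_trans fw; rewrite le_eqVlt; apply/orP; left; apply/eqP.
apply: eq_integral => x _ /=.
by rewrite -EFinM normrM (ger0_norm (w0 x)).
Qed.

Lemma integral_density D (f : T -> R) : measurable D -> measurable_fun D f ->
  mu.-integrable D (fun x => (f x * w x)%:E) ->
  (\int[density_measure]_(x in D) (f x)%:E = \int[mu]_(x in D) (f x * w x)%:E)%E.
Proof.
move=> mD mf ifw; have imf := integrable_density mD mf ifw.
rewrite [LHS]integralE [RHS]integralE; congr (_ - _)%E.
  rewrite ge0_integral_density//; last exact/measurable_funepos/measurable_EFinP.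
  apply: eq_integral => x _; rewrite !funeposE/= -!EFin_max -EFinM.
  by rewrite maxr_pMl// mul0r.
rewrite ge0_integral_density//; last exact/measurable_funeneg/measurable_EFinP.
apply: eq_integral => x _; rewrite !funenegE/= -!EFin_max -EFinM.
by rewrite maxr_pMl// mul0r mulNr.
Qed.

End density.

(** * Sums and densities of charges *)

Section charge_operations.
Context {R : realType}.
Local Notation T := (measurableTypeR R).
Implicit Types (nu : bcharge R) (D A : set T) (f g : T -> R).

Lemma cpos_fin nu : fin_num_fun (cpos nu).
Proof. by move=> A mA; rewrite fin_num_measure. Qed.

Lemma cneg_fin nu : fin_num_fun (cneg nu).
Proof. by move=> A mA; rewrite fin_num_measure. Qed.

Lemma measure_add_fin (m1 m2 : {measure set T -> \bar R}) :
  fin_num_fun m1 -> fin_num_fun m2 -> fin_num_fun (measure_add m1 m2).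
Proof.
move=> fin1 fin2 A mA.
have : (m1 A + m2 A)%E \is a fin_num by rewrite fin_numD fin1// fin2.
by rewrite -measure_addE.
Qed.

Lemma Rintegral_measure_add (m1 m2 : {measure set T -> \bar R}) D f :
  measurable D -> m1.-integrable D (EFin \o f) -> m2.-integrable D (EFin \o f) ->
  \int[measure_add m1 m2]_(x in D) f x =
  \int[m1]_(x in D) f x + \int[m2]_(x in D) f x.
Proof.
move=> mD f1 f2; rewrite /Rintegral integral_measure_add//.
by rewrite fineD// integrable_fin_num.
Qed.

Lemma cintegral_null nu D f :
  (forall A, measurable A -> nu A = 0%E) -> cintegral nu D f = 0.
Proof.
move=> nu0; rewrite /cintegral /Rintegral.
rewrite (@eq_measure_integral _ _ _ _ mzero); last first.
  by move=> A mA _; rewrite cposE// nu0//; apply: measurableI => //; exact: hahn_posP.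
rewrite (@eq_measure_integral _ _ _ _ mzero (cneg nu)); last first.
  by move=> A mA _; rewrite cnegE// nu0 ?oppe0//; apply: measurableI => //; exact: hahn_negP.
by rewrite integral_measure_zero subrr.
Qed.

Lemma cintegrable_null nu D f : measurable D -> measurable_fun D f ->
  (forall A, measurable A -> nu A = 0%E) -> cintegrable nu D f.
Proof.
move=> mD mf nu0; apply/cintegrableP => //.
have mef : measurable_fun D (EFin \o f) by exact/measurable_EFinP.
have m0 : mzero.-integrable D (EFin \o f).
  by apply/integrableP; split; rewrite ?integral_measure_zero.
split; apply: le_integrable_measure m0 => // A mA.
  by rewrite cposE// nu0//; apply: measurableI => //; exact: hahn_posP.
by rewrite cnegE// nu0 ?oppe0//; apply: measurableI => //; exact: hahn_negP.
Qed.

(** The Jordan parts of a sum are not the sums of the Jordan parts, but these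
    sums still are a pair to which [cintegral_diff] applies. *)
Lemma cintegral_cadd nu1 nu2 D f : measurable D ->
  cintegrable nu1 D f -> cintegrable nu2 D f ->
  cintegrable (cadd nu1 nu2) D f /\
  cintegral (cadd nu1 nu2) D f = cintegral nu1 D f + cintegral nu2 D f.
Proof.
move=> mD /(cintegrableP _ _ mD)[p1 n1] /(cintegrableP _ _ mD)[p2 n2].
have [] := @cintegral_diff _ (cadd nu1 nu2) (measure_add (cpos nu1) (cpos nu2))
  (measure_add (cneg nu1) (cneg nu2)) D f mD.
- exact: measure_add_fin (cpos_fin _) (cpos_fin _).
- exact: measure_add_fin (cneg_fin _) (cneg_fin _).
- move=> A mA; rewrite -[X in (X - _)%E]/(measure_add (cpos nu1) (cpos nu2) A).
  rewrite -[X in (_ - X)%E]/(measure_add (cneg nu1) (cneg nu2) A) !measure_addE.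
  transitivity (nu1 A + nu2 A)%E => //.
  rewrite (charge_jordanE nu1)// (charge_jordanE nu2)//.
  by rewrite oppeD ?fin_num_adde_defl ?cneg_fin// addeACA.
- exact: integrable_measure_add.
- exact: integrable_measure_add.
move=> iadd ->; split => //.
by rewrite !Rintegral_measure_add// /cintegral; lra.
Qed.

Lemma cintegral_copp nu D f : measurable D -> cintegrable nu D f ->
  cintegrable (copp nu) D f /\ cintegral (copp nu) D f = - cintegral nu D f.
Proof.
move=> mD /(cintegrableP _ _ mD)[p n].
have [] := @cintegral_diff _ (copp nu) (cneg nu) (cpos nu) D f mD
  (cneg_fin _) (cpos_fin _) _ n p.
  move=> A mA; transitivity (- nu A)%E => //; rewrite (charge_jordanE nu)//.
  by rewrite fin_num_oppeB ?cpos_fin ?cneg_fin// addeC.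
by move=> ? ->; rewrite /cintegral opprB.
Qed.

Lemma cintegral_induced (mu : {finite_measure set T -> \bar R}) g
    (ig : mu.-integrable [set: T] (EFin \o g)) D f :
  measurable D -> measurable_fun D f ->
  mu.-integrable D (fun x => (f x * g x)%:E) ->
  cintegrable (induced_charge ig) D f /\
  cintegral (induced_charge ig) D f = \int[mu]_(x in D) (f x * g x).
Proof.
move=> mD mf ifg.
have mg : measurable_fun D g.
  by apply/measurable_EFinP/measurable_funTS/measurable_int/ig.
have ip := integrable_funrpos measurableT ig.
have iN := integrable_funrneg measurableT ig.
have fgp : mu.-integrable D (fun x => (f x * g^\+ x)%:E).
  apply: le_integrable ifg => //.
    by apply/measurable_EFinP/measurable_funM => //; exact: measurable_funrpos.
  move=> x _; rewrite !abse_EFin lee_fin !normrM ler_wpM2l//.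
  by rewrite ger0_norm// -[leRHS]/((Num.norm \o g) x) -funrposDneg lerDl.
have fgn : mu.-integrable D (fun x => (f x * g^\- x)%:E).
  apply: le_integrable ifg => //.
    by apply/measurable_EFinP/measurable_funM => //; exact: measurable_funrneg.
  move=> x _; rewrite !abse_EFin lee_fin !normrM ler_wpM2l//.
  by rewrite ger0_norm// -[leRHS]/((Num.norm \o g) x) -funrposDneg lerDr.
pose m1 := density_measure (funrpos_ge0 g) ip.
pose m2 := density_measure (funrneg_ge0 g) iN.
have [] := @cintegral_diff _ (induced_charge ig) m1 m2 D f mD.
- by move=> A mA; rewrite fin_num_measure.
- by move=> A mA; rewrite fin_num_measure.
- move=> A mA; rewrite /= /induced_charge !density_measureE integralE.
  by rewrite funerpos funerneg.
- exact: integrable_density.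
- exact: integrable_density.
move=> ? ->; split => //.
rewrite /Rintegral !integral_density//.
transitivity (\int[mu]_(x in D) (f x * g^\+ x) - \int[mu]_(x in D) (f x * g^\- x)) => //.
rewrite -RintegralB//; apply: eq_Rintegral => x _.
by rewrite -mulrBr -[X in _ = _ * X]/(g x) -[in RHS](funrposBneg g).
Qed.

End charge_operations.

Section charge_density.
Context {R : realType}.
Local Notation T := (measurableTypeR R).
Implicit Types (nu : bcharge R) (D E A : set T) (f g : T -> R).

Lemma cintegral_cdensity nu g D f : measurable D -> measurable_fun D f ->
  cintegrable nu [set: T] g -> cintegrable nu D (fun x => f x * g x) ->
  cintegrable (cdensity g nu) D f /\
  cintegral (cdensity g nu) D f = cintegral nu D (fun x => f x * g x).
Proof.
move=> mD mf /(cintegrableP _ _ measurableT)[gp gn] /(cintegrableP _ _ mD)[fgp fgn].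
rewrite /cdensity; case: pselect => // gp'; case: pselect => // gn'.
have [ip Ep] := @cintegral_induced _ (fcpos nu) g gp' D f mD mf fgp.
have [iN EN] := @cintegral_induced _ (fcneg nu) g gn' D f mD mf fgn.
have [iN' EN'] := cintegral_copp mD iN.
have [ipn Epn] := cintegral_cadd mD ip iN'.
split; first exact ipn.
by rewrite Epn Ep EN' EN.
Qed.

(** Throughout, a charge is carried by a set when it vanishes on all measurable
    parts of the complement; vanishing of the charge on the complement itself
    would allow cancellations. *)
Lemma cpos_null nu A : measurable A ->
  (forall B, measurable B -> B `<=` A -> nu B = 0%E) -> cpos nu A = 0%E.
Proof.
move=> mA nu0; rewrite cposE// nu0//; apply: measurableI => //; exact: hahn_posP.
Qed.

Lemma cneg_null nu A : measurable A ->
  (forall B, measurable B -> B `<=` A -> nu B = 0%E) -> cneg nu A = 0%E.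
Proof.
move=> mA nu0; rewrite cnegE// nu0 ?oppe0//; apply: measurableI => //; exact: hahn_negP.
Qed.

Lemma cdensity_null nu g A : measurable A ->
  (forall B, measurable B -> B `<=` A -> nu B = 0%E) -> cdensity g nu A = 0%E.
Proof.
move=> mA nu0; rewrite /cdensity; case: pselect => // gp; case: pselect => // gn.
transitivity (\int[cpos nu]_(x in A) (g x)%:E - \int[cneg nu]_(x in A) (g x)%:E)%E => //.
rewrite !null_set_integral ?sube0//.
- by apply: measurable_funTS; exact: measurable_int gn.
- exact: cneg_null.
- by apply: measurable_funTS; exact: measurable_int gp.
- exact: cpos_null.
Qed.

Lemma cintegral_widen nu D E f : measurable D -> measurable E -> E `<=` D ->
  (forall B, measurable B -> B `<=` D `\` E -> nu B = 0%E) ->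
  measurable_fun D f -> cintegrable nu E f ->
  cintegrable nu D f /\ cintegral nu D f = cintegral nu E f.
Proof.
move=> mD mE ED nu0 mf /(cintegrableP _ _ mE)[fp fn].
have mDE : measurable (D `\` E) by exact: measurableD.
have mef : measurable_fun D (EFin \o f) by exact/measurable_EFinP.
have DDE : D `\` (D `\` E) = E by rewrite setDD setIC; exact/setIidPl.
have p0 := cpos_null mDE nu0; have n0 := cneg_null mDE nu0.
have fp' : (cpos nu).-integrable D (EFin \o f).
  by apply/(negligible_integrable mDE) => //; rewrite DDE.
have fn' : (cneg nu).-integrable D (EFin \o f).
  by apply/(negligible_integrable mDE) => //; rewrite DDE.
split; first exact/cintegrableP.
rewrite /cintegral /Rintegral (negligible_integral mDE mD fp' p0).
by rewrite (negligible_integral mDE mD fn' n0) DDE.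
Qed.

Lemma cintegrableS nu D E f : measurable D -> measurable E -> E `<=` D ->
  cintegrable nu D f -> cintegrable nu E f.
Proof. by move=> mD mE ED; exact: integrableS. Qed.

Lemma eq_cintegrable nu D f g : measurable D -> {in D, f =1 g} ->
  cintegrable nu D f -> cintegrable nu D g.
Proof. by move=> mD fg; apply: (eq_integrable mD) => x xD /=; rewrite fg. Qed.

Lemma eq_cintegral nu D f g : {in D, f =1 g} ->
  cintegral nu D f = cintegral nu D g.
Proof. by move=> fg; rewrite /cintegral !(eq_Rintegral _ fg). Qed.

Lemma cintegrable_fun0 nu D : cintegrable nu D (fun=> 0).
Proof. exact: integrable0. Qed.

Lemma cintegral_fun0 nu D : cintegral nu D (fun=> 0) = 0.
Proof. by rewrite /cintegral /Rintegral !integral0 subrr. Qed.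

Lemma cintegralD nu D f g : measurable D ->
  cintegrable nu D f -> cintegrable nu D g ->
  cintegrable nu D (fun x => f x + g x) /\
  cintegral nu D (fun x => f x + g x) = cintegral nu D f + cintegral nu D g.
Proof.
move=> mD fi gi; split; first exact: integrableD fi gi.
move/(cintegrableP _ _ mD) : fi => [fp fn]; move/(cintegrableP _ _ mD) : gi => [gp gn].
by rewrite /cintegral !RintegralD//; lra.
Qed.

Lemma cintegralZ nu D f c : measurable D -> cintegrable nu D f ->
  cintegrable nu D (fun x => c * f x) /\
  cintegral nu D (fun x => c * f x) = c * cintegral nu D f.
Proof.
move=> mD fi; split; first exact: integrableZl fi.
move/(cintegrableP _ _ mD) : fi => [fp fn].
by rewrite /cintegral !RintegralZl// mulrBr.
Qed.

Lemma cintegral_sum nu D I (r : seq I) (F : I -> T -> R) : measurable D ->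
  (forall i, cintegrable nu D (F i)) ->
  cintegrable nu D (fun x => \sum_(i <- r) F i x) /\
  cintegral nu D (fun x => \sum_(i <- r) F i x) = \sum_(i <- r) cintegral nu D (F i).
Proof.
move=> mD Fi; elim: r => [|i r [IHi IHE]].
  rewrite big_nil; split.
    by apply: eq_cintegrable (cintegrable_fun0 nu D) => // x _; rewrite big_nil.
  by rewrite -[RHS](cintegral_fun0 nu D); apply: eq_cintegral => x _; rewrite big_nil.
have [si sE] := cintegralD mD (Fi i) IHi; rewrite big_cons -IHE -sE; split.
  by apply: eq_cintegrable si => // x _; rewrite big_cons.
by apply: eq_cintegral => x _; rewrite big_cons.
Qed.

Lemma le_normr_cintegral nu D f : measurable D -> cintegrable nu D f ->
  (`|cintegral nu D f|%:E <= \int[cvariation nu]_(x in D) `|f x|%:E)%E.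
Proof.
move=> mD fi; have /(cintegrableP _ _ mD)[fp fn] := fi.
rewrite (_ : \int[cvariation nu]_(x in D) _ =
             \int[measure_add (cpos nu) (cneg nu)]_(x in D) `|f x|%:E)%E; last first.
  apply: eq_measure_integral => A mA _.
  by rewrite -[RHS]/(measure_add (cpos nu) (cneg nu) A) measure_addE.
have mnf : measurable_fun D (fun x => `|f x|%:E).
  apply/measurable_EFinP/measurableT_comp => //.
  by apply/measurable_EFinP; exact: measurable_int fi.
rewrite ge0_integral_measure_add//.
apply: (@le_trans _ _ (`|\int[cpos nu]_(x in D) f x|%:E + `|\int[cneg nu]_(x in D) f x|%:E)%E).
  by rewrite -EFinD lee_fin; exact: ler_normB.
by apply: leeD; rewrite EFin_normr_Rintegral//; apply: le_abse_integral => //;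
  apply/measurable_EFinP; apply/measurable_EFinP; exact: measurable_int fi.
Qed.

End charge_density.

(** * The entries of a product matrix *)

Section charge_sums.
Context {R : realType}.
Local Notation T := (measurableTypeR R).
Local Notation bigcadd r F :=
  (\big[(@cadd _ _ _ : bcharge R -> bcharge R -> bcharge R)/(czero : bcharge R)]_(i <- r) F i).
Implicit Types (D A : set T) (f : T -> R).

Lemma cintegral_bigcadd (I : eqType) (r : seq I) (F : I -> bcharge R) D f :
  measurable D -> measurable_fun D f ->
  (forall i, i \in r -> cintegrable (F i) D f) ->
  cintegrable (bigcadd r F) D f /\
  cintegral (bigcadd r F) D f = \sum_(i <- r) cintegral (F i) D f.
Proof.
move=> mD mf; elim: r => [|i r IH] Fi.
  rewrite !big_nil; split; first exact: cintegrable_null.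
  exact: cintegral_null.
have [|ir Er] := IH; first by move=> j jr; apply: Fi; rewrite inE jr orbT.
have iF : cintegrable (F i) D f by apply: Fi; rewrite mem_head.
have [ia Ea] := cintegral_cadd mD iF ir.
by rewrite !big_cons; split; [exact ia | rewrite -Er; exact Ea].
Qed.

Lemma bigcadd_null (I : eqType) (r : seq I) (F : I -> bcharge R) A :
  (forall i, i \in r -> F i A = 0%E) -> bigcadd r F A = 0%E.
Proof.
elim: r => [|i r IH] F0; rewrite ?big_nil ?big_cons//.
transitivity (F i A + bigcadd r F A)%E => //.
rewrite F0 ?mem_head// IH ?adde0// => j jr.
by apply: F0; rewrite inE jr orbT.
Qed.

End charge_sums.

Section finite_rows.
Context {S V : nmodType}.

Lemma mem_finite_support (u : nat -> S) n :
  (forall k, (n <= k)%N -> u k = 0) ->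
  forall k, (k \in finite_support 0 [set: nat] u) = (u k != 0).
Proof.
move=> u0 k; rewrite in_finite_support ?inE/=.
  apply/idP/idP => [|/eqP uk]; last by rewrite inE.
  by rewrite inE => -[_ /= /eqP].
apply: (sub_finite_set _ (finite_II n)) => l [_ /= ul].
by rewrite /= ltnNge; apply/negP => /u0.
Qed.

Lemma sum_finite_support (u : nat -> S) (F : nat -> V) n :
  (forall k, (n <= k)%N -> u k = 0) -> (forall k, u k = 0 -> F k = 0) ->
  \sum_(k <- finite_support 0 [set: nat] u) F k = \sum_(k < n) F k.
Proof.
move=> u0 F0; rewrite -(big_mkord xpredT F) /index_iota subn0.
rewrite [RHS](bigID (fun k => k \in finite_support 0 [set: nat] u))/= [X in _ + X]big1 ?addr0.
  rewrite -[RHS]big_filter; apply: perm_big; apply: uniq_perm => //.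
  - exact: finite_support_uniq.
  - by rewrite filter_uniq// iota_uniq.
  move=> k; rewrite mem_filter (mem_finite_support u0) mem_iota add0n.
  apply/idP/idP => [uk|/andP[]//]; rewrite uk/=.
  by rewrite ltnNge; apply: contra uk => /u0 ->.
by move=> k; rewrite (mem_finite_support u0) negbK => /eqP /F0.
Qed.

End finite_rows.

Section polynomial_integrability.
Context {R : realType}.

(** A measure matrix integrates the products [p^(k) q^(l)]; these are all the
    polynomials because polynomials have antiderivatives. *)
Lemma derivn_surj (n : nat) (p : {poly R}) : exists q : {poly R}, q^`(n) = p.
Proof.
elim: n p => [|n IH] p; first by exists p.
have [q <-] := IH p.
exists (\poly_(i < (size q).+1) (q`_i.-1 / i%:R)).
rewrite derivSn; congr derivn; apply/polyP => i.
rewrite coef_deriv coef_poly ltnS.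
case: ltnP => [_|qi]; last by rewrite mul0rn nth_default.
by rewrite -[LHS]mulr_natr divfK// pnatr_eq0.
Qed.

Lemma measure_matrix_poly (W : charge_matrix R) (p : {poly R}) k l :
  is_measure_matrix W -> cintegrable (W k l) (cm_dom W k l) (horner p).
Proof.
move=> [mW _ iW]; have [q qp] := derivn_surj k p; have [q1 q1E] := derivn_surj l 1.
apply: eq_cintegrable (iW q q1 k l) => // x _.
by rewrite !derive1n_horner qp q1E hornerC mulr1.
Qed.

End polynomial_integrability.

Section product_integrals.
Context {R : realType}.
Local Notation T := (measurableTypeR R).
Variables (W : charge_matrix R) (hW : is_measure_matrix W).
Variables (P Q : smx {poly R}) (dP dQ : nat).
Hypothesis P0 : forall i k, (i + dP < k)%N -> P i k = 0.
Hypothesis Q0 : forall l j, (j + dQ < l)%N -> Q l j = 0.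
Local Notation LW := (pmx_mul P W Q).
Implicit Types (A : set T) (f h phi : T -> R).

Lemma pmx_mul_dom_sub i j k l : P i k != 0 -> Q l j != 0 ->
  cm_dom W k l `<=` cm_dom LW i j.
Proof. by move=> Pik Qlj x Wx; exists (k, l). Qed.

Lemma measurable_pmx_mul_dom i j : measurable (cm_dom LW i j : set T).
Proof.
have [mW _ _] := hW; apply: fin_bigcup_measurable => //.
apply: (@sub_finite_set _ _ (`I_(i + dP).+1 `*` `I_(j + dQ).+1)); last exact: finite_setX.
move=> [k l] [/= Pik Qlj]; split => /=; rewrite ltnS leqNgt; apply/negP.
  by move=> /P0 Pik0; rewrite Pik0 eqxx in Pik.
by move=> /Q0 Qlj0; rewrite Qlj0 eqxx in Qlj.
Qed.

Let row_bound i n k : (i + dP < n)%N -> (n <= k)%N -> P i k = 0.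
Proof. by move=> iN nk; apply: P0; exact: leq_trans nk. Qed.

Let col_bound j n l : (j + dQ < n)%N -> (n <= l)%N -> Q l j = 0.
Proof. by move=> jn nl; apply: Q0; exact: leq_trans nl. Qed.

Lemma pmx_mul_carried i j A : measurable A -> A `<=` ~` cm_dom LW i j ->
  pmx_mul P W Q i j A = 0%E.
Proof.
have [_ W0 _] := hW; move=> mA AD /=.
apply: bigcadd_null => k; rewrite (mem_finite_support (fun k => @row_bound i _ k (ltnSn _))) => Pik.
apply: bigcadd_null => l; rewrite (mem_finite_support (fun l => @col_bound j _ l (ltnSn _))) => Qlj.
apply: cdensity_null => // B mB BA; apply: W0 => // x /BA /AD NWx Wx.
by apply: NWx; exact: (pmx_mul_dom_sub Pik Qlj).
Qed.

(** An entry of [P W Q] is a finite sum of densities, hence integrated term by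
    term. The set [A] is there for truncations: only the parts over [A] of the
    terms need to converge. *)
Lemma cintegral_pmx_mul i j A phi (n m : nat) : (i + dP < n)%N -> (j + dQ < m)%N ->
  measurable A -> measurable_fun (cm_dom LW i j `&` A) phi ->
  (forall k l, P i k != 0 -> Q l j != 0 ->
    cintegrable (W k l) (cm_dom W k l `&` A) (fun x => phi x * (P i k * Q l j).[x])) ->
  cintegrable (LW i j) (cm_dom LW i j `&` A) phi /\
  cintegral (LW i j) (cm_dom LW i j `&` A) phi =
    \sum_(k < n) \sum_(l < m)
      cintegral (W k l) (cm_dom W k l `&` A) (fun x => phi x * (P i k * Q l j).[x]).
Proof.
move=> iN jm mA mphi iW; have [mW W0 _] := hW.
have mD := measurableI _ _ (measurable_pmx_mul_dom i j) mA.
pose t k l := cintegral (W k l) (cm_dom W k l `&` A) (fun x => phi x * (P i k * Q l j).[x]).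
have tP k l : P i k = 0 -> t k l = 0.
  move=> Pik; rewrite /t -[RHS](cintegral_fun0 (W k l) (cm_dom W k l `&` A)).
  by apply: eq_cintegral => x _; rewrite Pik mul0r horner0 mulr0.
have tQ k l : Q l j = 0 -> t k l = 0.
  move=> Qlj; rewrite /t -[RHS](cintegral_fun0 (W k l) (cm_dom W k l `&` A)).
  by apply: eq_cintegral => x _; rewrite Qlj mulr0 horner0 mulr0.
have suppP k := mem_finite_support (fun k => @row_bound i n k iN) k.
have suppQ l := mem_finite_support (fun l => @col_bound j m l jm) l.
have den k l : P i k != 0 -> Q l j != 0 ->
    cintegrable (cdensity (horner (P i k * Q l j)) (W k l)) (cm_dom LW i j `&` A) phi /\
    cintegral (cdensity (horner (P i k * Q l j)) (W k l)) (cm_dom LW i j `&` A) phi = t k l.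
  move=> Pik Qlj; have sub := pmx_mul_dom_sub Pik Qlj.
  have mpoly D : measurable_fun (D : set T) (horner (P i k * Q l j)).
    by apply: measurable_funTS; apply: continuous_measurable_fun; exact: continuous_horner.
  have [ipoly _] : cintegrable (W k l) [set: T] (horner (P i k * Q l j)) /\ _ :=
    cintegral_widen measurableT (mW k l) (@subsetT _ _)
      (fun B mB BD => W0 k l B mB (fun x Bx => (BD x Bx).2))
      (mpoly _) (measure_matrix_poly _ k l hW).
  (* [W k l] does not charge the difference of the two domains. *)
  have W0D B : measurable B ->
      B `<=` (cm_dom LW i j `&` A) `\` (cm_dom W k l `&` A) -> W k l B = 0%E.
    move=> mB BD; apply: W0 => // x Bx Wx; have [[_ Ax] NWA] := BD _ Bx.
    exact: NWA.
  have [iD ED] := @cintegral_widen _ (W k l) (cm_dom LW i j `&` A) (cm_dom W k l `&` A)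
    (fun x => phi x * (P i k * Q l j).[x]) mD (measurableI _ _ (mW k l) mA)
    (@setSI _ _ _ _ sub) W0D (measurable_funM mphi (mpoly _)) (iW k l Pik Qlj).
  by rewrite /t -ED; exact: cintegral_cdensity.
pose row_charge k : bcharge R :=
  \big[(@cadd _ _ _ : bcharge R -> bcharge R -> bcharge R)/(czero : bcharge R)]_
  (l <- finite_support 0 [set: nat] (Q ^~ j))
    cdensity (horner (P i k * Q l j)) (W k l).
have row k : P i k != 0 ->
    cintegrable (row_charge k) (cm_dom LW i j `&` A) phi /\
    cintegral (row_charge k) (cm_dom LW i j `&` A) phi = \sum_(l < m) t k l.
  move=> Pik; have [|iD ED] := cintegral_bigcadd
      (r := finite_support 0 [set: nat] (Q ^~ j))
      (F := fun l => cdensity (horner (P i k * Q l j)) (W k l)) mD mphi.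
    by move=> l; rewrite suppQ => Qlj; have [] := den k l Pik Qlj.
  split => //; rewrite ED -(@sum_finite_support _ _ (Q ^~ j) (t k) m); last by move=> l; exact: tQ.
    by apply: eq_big_seq => l; rewrite suppQ => Qlj; have [] := den k l Pik Qlj.
  by move=> l; exact: col_bound.
have [|iD ED] := cintegral_bigcadd
    (r := finite_support 0 [set: nat] (P i)) (F := row_charge) mD mphi.
  by move=> k; rewrite suppP => Pik; have [] := row k Pik.
split => //; rewrite [LHS]ED -(@sum_finite_support _ _ (P i) (fun k => \sum_(l < m) t k l) n).
- by apply: eq_big_seq => k; rewrite suppP => Pik; have [] := row k Pik.
- by move=> k; exact: row_bound.
- by move=> k Pik; rewrite big1// => l _; exact: tP.
Qed.

End product_integrals.

(** * Unconditional sums *)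

Section unconditional_sums.
Context {R : realType}.

(** For nonnegative families, a finite subfamily with almost the full sum is
    eventually contained in [s m]. *)
Lemma nneg_summable_cvg (I : choiceType) (v : I -> R) (s : nat -> seq I) :
  (forall q, 0 <= v q) -> (\esum_(q in [set: I]) (v q)%:E < +oo)%E ->
  (forall m, uniq (s m)) -> (forall q, \forall m \near \oo, q \in s m) ->
  (fun m => \sum_(q <- s m) v q) @ \oo --> fine (\esum_(q in [set: I]) (v q)%:E)%E.
Proof.
move=> v0 vfin su sE; set S := (\esum_(q in [set: I]) (v q)%:E)%E.
have Sfin : S \is a fin_num.
  by rewrite ge0_fin_numE// esum_ge0// => q _; rewrite lee_fin.
have le_S m : \sum_(q <- s m) v q <= fine S.
  rewrite -lee_fin fineK// -sumEFin; apply: esum_ge; exists [set` s m] => //.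
  by rewrite -fsbig_seq.
apply/cvgrPdist_lt => e e0.
have [_ [X [finX _] <-]] := ub_ereal_sup_adherent e0 Sfin.
rewrite -/(esum _ _) -/S fsbig_finite//= sumEFin => SX.
have ur : uniq (finmap.enum_fset (fset_set X)) by exact: finmap.fset_uniq.
move: (finmap.enum_fset _) ur SX => r ur SX.
have nearX : \forall m \near \oo, forall q, q \in r -> q \in s m.
  elim: r {ur SX} => [|q r IH]; first by near=> m.
  near=> m => q'; rewrite inE => /predU1P[->|]; first by near: m; exact: sE.
  by move: q'; near: m.
near=> m; rewrite ger0_norm ?subr_ge0// ltrBlDr -ltrBlDl.
rewrite -lte_fin EFinB fineK//; apply: (lt_le_trans SX); rewrite lee_fin.
have -> : \sum_(q <- s m) v q = \sum_(q <- r) v q +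
    \sum_(q <- s m | q \notin r) v q.
  rewrite (bigID (fun q => q \in r))/=; congr (_ + _).
  rewrite -big_filter; apply: perm_big; apply: uniq_perm.
  - by rewrite filter_uniq.
  - exact: ur.
  move=> q; rewrite mem_filter; apply: andb_idr.
  by move: q; near: m.
by rewrite lerDl sumr_ge0.
Unshelve. all: by end_near. Qed.

Lemma esum_lty (I : choiceType) (v : I -> \bar R) (r : seq I) :
  (forall x, 0 <= v x)%E -> (forall x, v x < +oo)%E ->
  (forall x, x \notin r -> v x = 0%E) -> (\esum_(x in [set: I]) v x < +oo)%E.
Proof.
move=> v0 vfin vr.
have -> : (\esum_(x in [set: I]) v x = \esum_(x in [set` r]) v x)%E.
  rewrite [RHS]esum_mkcond; apply: eq_esum => x _; case: ifPn => //.
  by rewrite notin_setE /= => /negP /vr.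
rewrite (esum_fset (finite_seq r)) => [|x _]; last exact: v0.
by rewrite fsbig_finite//=; apply: lte_sum_pinfty.
Qed.

(** The limit does not depend on the exhaustion: it is the difference of the
    sums of the positive and negative parts. *)
Lemma summable_cvg_unique (I : choiceType) (u : I -> R) :
  (\esum_(q in [set: I]) `|u q|%:E < +oo)%E ->
  exists S : R, forall s : nat -> seq I, (forall m, uniq (s m)) ->
    (forall q, \forall m \near \oo, q \in s m) ->
    (fun m => \sum_(q <- s m) u q) @ \oo --> S.
Proof.
move=> ufin.
have pfin : (\esum_(q in [set: I]) (u^\+ q)%:E < +oo)%E.
  apply: le_lt_trans ufin; apply: le_esum => q _; rewrite lee_fin.
  by rewrite -[leRHS]/((Num.norm \o u) q) -funrposDneg lerDl.
have nfin : (\esum_(q in [set: I]) (u^\- q)%:E < +oo)%E.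
  apply: le_lt_trans ufin; apply: le_esum => q _; rewrite lee_fin.
  by rewrite -[leRHS]/((Num.norm \o u) q) -funrposDneg lerDr.
exists (fine (\esum_(q in [set: I]) (u^\+ q)%:E)%E - fine (\esum_(q in [set: I]) (u^\- q)%:E)%E).
move=> s us sE.
have -> : (fun m => \sum_(q <- s m) u q) =
    (fun m => \sum_(q <- s m) u^\+ q) - (fun m => \sum_(q <- s m) u^\- q).
  apply/funext => m; rewrite !fctE -sumrB; apply: eq_bigr => q _.
  by rewrite -[LHS]/(u q) -{1}(funrposBneg u).
by apply: cvgB; apply: nneg_summable_cvg => // q;
  rewrite ?funrpos_ge0 ?funrneg_ge0.
Qed.

Local Notation index := ((nat * nat) * (nat * nat))%type.

(** The index sets of the partial sums of the two bilinear forms, once all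
    entries are expanded. *)
Definition box (a b c d : nat) : seq index :=
  [seq (p, q) | p <- [seq (i, j) | i <- iota 0 a, j <- iota 0 b],
                q <- [seq (k, l) | k <- iota 0 c, l <- iota 0 d]].

Lemma box_uniq a b c d : uniq (box a b c d).
Proof.
by rewrite !allpairs_uniq ?iota_uniq//; move=> [? ?] [? ?] _ _.
Qed.

Lemma mem_box a b c d (q : index) :
  (q \in box a b c d) = [&& (q.1.1 < a)%N, (q.1.2 < b)%N, (q.2.1 < c)%N & (q.2.2 < d)%N].
Proof.
case: q => [[i j] [k l]]/=; apply/allpairsP/and4P => [[[p q] /= []]|[ia jb kc ld]].
  move=> /allpairsP[[i' j'] /= [+ + ->]] /allpairsP[[k' l'] /= [+ + ->]] [-> -> -> ->].
  by rewrite !mem_iota.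
exists ((i, j), (k, l)); split => //=; apply/allpairsP; [exists (i, j)|exists (k, l)];
  by split; rewrite //= mem_iota.
Qed.

Lemma sum_box a b c d (u : index -> R) :
  \sum_(q <- box a b c d) u q =
  \sum_(i < a) \sum_(j < b) \sum_(k < c) \sum_(l < d) u ((i : nat, j : nat), (k : nat, l : nat)).
Proof.
rewrite big_allpairs big_allpairs -[in iota 0 a](subn0 a) big_mkord.
apply: eq_bigr => i _; rewrite -[in iota 0 b](subn0 b) big_mkord; apply: eq_bigr => j _.
rewrite big_allpairs -[in iota 0 c](subn0 c) big_mkord.
by apply: eq_bigr => k _; rewrite -[in iota 0 d](subn0 d) big_mkord.
Qed.

Lemma summable_box_cvg (u : index -> R) :
  (\esum_(q in [set: index]) `|u q|%:E < +oo)%E ->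
  exists S : R, forall a b c d : nat -> nat,
    (forall m, [&& m <= a m, m <= b m, m <= c m & m <= d m]%N) ->
    (fun m => \sum_(i < a m) \sum_(j < b m) \sum_(k < c m) \sum_(l < d m)
       u ((i : nat, j : nat), (k : nat, l : nat))) @ \oo --> S.
Proof.
move=> /summable_cvg_unique[S cvgS]; exists S => a b c d abcd.
under eq_fun do rewrite -sum_box; apply: cvgS => [m|q]; first exact: box_uniq.
near=> m; rewrite mem_box; have /and4P[am bm cm dm] := abcd m.
apply/and4P; split; [apply: leq_trans am|apply: leq_trans bm|
  apply: leq_trans cm|apply: leq_trans dm]; near: m; exact: nbhs_infty_gt.
Unshelve. all: by end_near. Qed.

End unconditional_sums.

(** * Expansion of the bilinear forms *)

Section exhaustion.
Context {R : realType}.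

Lemma cvg_sumr n (F : 'I_n -> nat -> R) (l : 'I_n -> R) :
  (forall i, F i @ \oo --> l i) ->
  (fun m => \sum_(i < n) F i m) @ \oo --> \sum_(i < n) l i.
Proof. by move=> Fl; apply: cvg_big => //; exact: add_continuous. Qed.

Local Notation T := (measurableTypeR R).
Implicit Types (D : set T) (A : nat -> set T) (f : T -> R).

Lemma Rintegral_exhaust (mu : {measure set T -> \bar R}) D A f :
  measurable D -> (forall m, measurable (A m)) ->
  (forall x, \forall m \near \oo, A m x) -> mu.-integrable D (EFin \o f) ->
  (fun m => \int[mu]_(x in D `&` A m) f x) @ \oo --> \int[mu]_(x in D) f x.
Proof.
move=> mD mA Acov fi; under eq_fun do rewrite Rintegral_mkcondr.
have mef := measurable_int _ fi.
have mf : measurable_fun D f by exact/measurable_EFinP.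
have mfA m : measurable_fun D (f \_ (A m)).
  by apply/(measurable_restrict _ (mA m) mD); apply: measurable_funS mf.
have [||||_ _] := @dominated_convergence _ _ _ mu D mD
  (fun m => EFin \o (f \_ (A m))) (EFin \o f) (abse \o (EFin \o f)) _ mef.
- by move=> m; exact/measurable_EFinP.
- apply/aeW => x Dx; apply: cvg_near_cst; near=> m.
  by rewrite /= patchE mem_set//; near: m; exact: Acov.
- exact: integrable_abse.
- apply/aeW => x m Dx; rewrite /= patchE lee_fin.
  by case: ifP => // _; rewrite normr0.
by move=> cvgI; apply: fine_cvg; rewrite fineK//; exact: integrable_fin_num.
Unshelve. all: by end_near. Qed.

Lemma cintegral_exhaust (nu : bcharge R) D A f :
  measurable D -> (forall m, measurable (A m)) ->
  (forall x, \forall m \near \oo, A m x) -> cintegrable nu D f ->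
  (fun m => cintegral nu (D `&` A m) f) @ \oo --> cintegral nu D f.
Proof.
move=> mD mA Acov /(cintegrableP _ _ mD)[fp fn].
by apply: cvgB; exact: Rintegral_exhaust.
Qed.

End exhaustion.

Section sform_theory.
Context {R : realType}.
Implicit Types (W : charge_matrix R) (f h : R -> R).

(** When almost all terms vanish the limit defining the form is stationary. *)
Lemma sform_finite W f h (N M : nat) :
  (forall n r, (N <= n)%N \/ (M <= r)%N -> term_integral W f h n r = 0) ->
  sform W f h = \sum_(n < N) \sum_(r < M) term_integral W f h n r.
Proof.
move=> t0; apply: cvg_lim => //; apply: cvg_near_cst.
near=> m.
have Nm : (N <= m)%N by near: m; exact: nbhs_infty_ge.
have Mm : (M <= m)%N by near: m; exact: nbhs_infty_ge.
rewrite (@sum_ord_trunc _ _ _ (fun n => \sum_(r < m) term_integral W f h n r) Nm); last first.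
  by move=> n Nn; rewrite big1// => r _; apply: t0; left.
apply: eq_bigr => n _; apply: (@sum_ord_trunc _ _ _ (term_integral W f h n) Mm).
by move=> r Mr; apply: t0; right.
Unshelve. all: by end_near. Qed.

Lemma derive1n_ldo_app_widen (a : ldo R) (U : set R) f k n :
  open U -> derivable_upto U (k + ldo_order a) f -> (k + ldo_order a < n)%N ->
  forall x, U x -> derive1n k (ldo_app a f) x =
    \sum_(i < n) derive1n i f x * (ldo_pmx a i k).[x].
Proof.
move=> oU df kn x Ux; rewrite (derive1n_ldo_app oU df Ux).
apply/esym; apply: (@sum_ord_trunc _ _ _
  (fun i => derive1n i f x * (ldo_pmx a i k).[x]) kn) => i ki.
by rewrite ldo_pmx_lower ?horner0 ?mulr0.
Qed.

End sform_theory.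

Section expansion.
Context {R : realType}.
Local Notation T := (measurableTypeR R).
Variables (W : charge_matrix R) (hW : is_measure_matrix W) (a1 a2 : ldo R).
Local Notation P := (ldo_pmx a1).
Local Notation Q := (smx_tr (ldo_pmx a2)).
Local Notation LW := (pmx_mul P W Q).
Implicit Types (A U : set T) (f h : T -> R).

Definition pmx_summand f h i j k l : T -> R :=
  fun x => derive1n i f x * derive1n j h x * (P i k * Q l j).[x].

Definition pmx_term A f h i j k l : R :=
  cintegral (W k l) (cm_dom W k l `&` A) (pmx_summand f h i j k l).

Lemma pmx_summand0 f h i j k l : P i k * Q l j = 0 -> pmx_summand f h i j k l = fun=> 0.
Proof. by move=> PQ0; apply/funext => x; rewrite /pmx_summand PQ0 horner0 mulr0. Qed.

(** On the support of [W k l], the product of the derivatives of the two images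
    is the sum of the integrands [pmx_summand f h i j k l]. *)
Lemma cintegral_ldo_app A U f h k l (n m : nat) :
  open U -> cm_dom W k l `<=` U ->
  derivable_upto U (k + ldo_order a1) f -> derivable_upto U (l + ldo_order a2) h ->
  (k + ldo_order a1 < n)%N -> (l + ldo_order a2 < m)%N -> measurable A ->
  (forall i j, cintegrable (W k l) (cm_dom W k l `&` A) (pmx_summand f h i j k l)) ->
  cintegral (W k l) (cm_dom W k l `&` A)
    (fun x => derive1n k (ldo_app a1 f) x * derive1n l (ldo_app a2 h) x) =
  \sum_(i < n) \sum_(j < m) pmx_term A f h i j k l.
Proof.
move=> oU WU df dh kn lm mA iW; have [mW _ _] := hW.
have mD := measurableI _ _ (mW k l) mA.
have inner i := cintegral_sum (F := fun j => pmx_summand f h i j k l)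
  (index_enum 'I_m) mD (fun j => iW i j).
have [_ outer] := cintegral_sum (index_enum 'I_n) mD (fun i : 'I_n => (inner i).1).
transitivity (\sum_(i < n) cintegral (W k l) (cm_dom W k l `&` A)
    (fun x => \sum_(j < m) pmx_summand f h i j k l x)); last first.
  by apply: eq_bigr => i _; rewrite (inner i).2.
rewrite -outer; apply: eq_cintegral => x; rewrite inE => -[Wx _].
rewrite (derive1n_ldo_app_widen oU df kn (WU _ Wx)).
rewrite (derive1n_ldo_app_widen oU dh lm (WU _ Wx)).
rewrite mulr_suml; apply: eq_bigr => i _; rewrite mulr_sumr; apply: eq_bigr => j _.
by rewrite /pmx_summand hornerM; ring.
Qed.

Lemma is_measure_matrix_pmx_mul : is_measure_matrix LW.
Proof.
split.
- by move=> i j; exact: (measurable_pmx_mul_dom hW (@ldo_pmx_upper _ a1) (@ldo_pmx_tr_upper _ a2)).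
- by move=> i j A; exact: (pmx_mul_carried hW (@ldo_pmx_upper _ a1) (@ldo_pmx_tr_upper _ a2)).
- move=> p q i j; rewrite /term_integrable -[cm_dom _ _ _]setIT.
  have mpoly : forall D, measurable_fun (D : set T)
      (fun x => derive1n i (horner p) x * derive1n j (horner q) x).
    move=> D; apply: measurable_funTS; rewrite !derive1n_horner.
    by apply: measurable_funM; apply: continuous_measurable_fun; exact: continuous_horner.
  have [] := cintegral_pmx_mul hW (@ldo_pmx_upper _ a1) (@ldo_pmx_tr_upper _ a2)
    (ltnSn _) (ltnSn _) (i := i) (j := j)
    measurableT (mpoly _) => //.
  move=> k l _ _; rewrite setIT.
  apply: eq_cintegrable (measure_matrix_poly (p^`(i) * q^`(j) * (P i k * Q l j)) k l hW).
    by have [mW _ _] := hW.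
  by move=> x _; rewrite !derive1n_horner !hornerM.
Qed.

End expansion.

(** * Matrices of infinite order *)

Section infinite_order.
Context {R : realType}.
Local Notation T := (measurableTypeR R).
Variables (W : charge_matrix R) (hW : is_measure_matrix W) (a1 a2 : ldo R).
Local Notation P := (ldo_pmx a1).
Local Notation Q := (smx_tr (ldo_pmx a2)).
Local Notation LW := (pmx_mul P W Q).
Local Notation index := ((nat * nat) * (nat * nat))%type.

(** Both forms are limits of partial sums of the same summable family
    [pmx_term], one over [k, l < m] and all [i, j], the other over [i, j < m] and
    all [k, l]. *)
Theorem sform_ldo_app_summable (U : set R) (f h : R -> R) :
  open U -> (forall i j, cm_dom W i j `<=` U) ->
  (forall n, derivable_upto U n f) -> (forall n, derivable_upto U n h) ->
  expanded_summable P W Q f h ->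
  sform W (ldo_app a1 f) (ldo_app a2 h) = sform LW f h.
Proof.
move=> oU WU df dh sfh; have [mW _ _] := hW.
have mU n g : (forall n, derivable_upto U n g) ->
    measurable_fun (U : set T) (derive1n n g).
  move=> dg; apply: open_continuous_measurable_fun => // x; rewrite inE => Ux.
  by apply/differentiable_continuous/derivable1_diffP; exact: (dg n.+1).
have mG i j D : D `<=` U ->
    measurable_fun (D : set T) (fun x => derive1n i f x * derive1n j h x).
  move=> DU; apply: measurable_funS DU _; first exact: open_measurable.
  by apply: measurable_funM; exact: mU.
have mpoly D (p : {poly R}) : measurable_fun (D : set T) (horner p).
  by apply: measurable_funTS; apply: continuous_measurable_fun; exact: continuous_horner.
pose v (q : index) : \bar R :=
  (\int[cvariation (W q.2.1 q.2.2)]_(x in cm_dom W q.2.1 q.2.2)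
     `|pmx_summand a1 a2 f h q.1.1 q.1.2 q.2.1 q.2.2 x|%:E)%E.
have v0 q : (0 <= v q)%E by apply: integral_ge0 => x _; rewrite lee_fin.
have vfin : (\esum_(q in [set: index]) v q < +oo)%E.
  apply: le_lt_trans sfh; apply: le_esum => q _; rewrite /v.
  by under eq_integral do rewrite /pmx_summand hornerM mulrA.
have iT i j k l : cintegrable (W k l) (cm_dom W k l) (pmx_summand a1 a2 f h i j k l).
  apply/integrableP; split.
    by apply/measurable_EFinP/measurable_funM => //; exact: mG.
  apply: le_lt_trans vfin; apply: esum_ge; exists [set ((i, j), (k, l))] => //.
  by rewrite fsbig_set1.
pose t (q : index) := pmx_term W a1 a2 [set: T] f h q.1.1 q.1.2 q.2.1 q.2.2.
have tfin : (\esum_(q in [set: index]) `|t q|%:E < +oo)%E.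
  apply: le_lt_trans vfin; apply: le_esum => q _; rewrite /t /pmx_term setIT.
  exact: le_normr_cintegral.
(* The entry [P i k] vanishes for [i] beyond [k + ldo_order a1] and for [k]
   beyond [i + ldo_deg a1], so that these finite ranges hold all terms. *)
have lhs m : \sum_(k < m) \sum_(l < m) term_integral W (ldo_app a1 f) (ldo_app a2 h) k l =
    \sum_(i < m + (ldo_order a1).+1) \sum_(j < m + (ldo_order a2).+1)
      \sum_(k < m) \sum_(l < m) t ((i : nat, j : nat), (k : nat, l : nat)).
  rewrite (exchange_sum4 _ _ _ _ (fun i j k l => t ((i, j), (k, l)))).
  apply: eq_bigr => k _; apply: eq_bigr => l _.
  rewrite /term_integral -[cm_dom W k l]setIT; apply: cintegral_ldo_app oU _ _ _ _ _ _ _ => //.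
  - by have := ltn_ord k; lia.
  - by have := ltn_ord l; lia.
  - by move=> i j; rewrite setIT.
have rhs m : \sum_(i < m) \sum_(j < m) term_integral LW f h i j =
    \sum_(i < m) \sum_(j < m)
      \sum_(k < m + (ldo_deg a1).+1) \sum_(l < m + (ldo_deg a2).+1)
        t ((i : nat, j : nat), (k : nat, l : nat)).
  apply: eq_bigr => i _; apply: eq_bigr => j _.
  rewrite /term_integral -[cm_dom LW i j]setIT.
  apply: (cintegral_pmx_mul hW (@ldo_pmx_upper _ a1) (@ldo_pmx_tr_upper _ a2) _ _ measurableT _ _).2.
  - by have := ltn_ord i; lia.
  - by have := ltn_ord j; lia.
  - by apply: mG => x [[kl _ /WU]].
  - by move=> k l _ _; rewrite setIT; exact: iT.
have [S cvgS] := summable_box_cvg tfin.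
transitivity S.
  apply: cvg_lim => //; under eq_fun do rewrite lhs.
  by apply: cvgS => m; apply/and4P; split; lia.
apply/esym; apply: cvg_lim => //; under eq_fun do rewrite rhs.
by apply: cvgS => m; apply/and4P; split; lia.
Qed.

End infinite_order.

(** * Polynomials and Gram matrices *)

Section polynomials.
Context {R : realType}.
Local Notation T := (measurableTypeR R).
Variables (W : charge_matrix R) (hW : is_measure_matrix W) (a1 a2 : ldo R).
Local Notation P := (ldo_pmx a1).
Local Notation Q := (smx_tr (ldo_pmx a2)).
Local Notation LW := (pmx_mul P W Q).
Local Notation index := ((nat * nat) * (nat * nat))%type.

(** For polynomials only finitely many terms are nonzero: the derivatives of [p]
    and [q] vanish eventually and the rows of [P] and columns of [Q] are finite. *)
Lemma expanded_summable_horner (p q : {poly R}) :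
  expanded_summable P W Q (horner p) (horner q).
Proof.
have [mW _ _] := hW.
rewrite /expanded_summable; set v := (X in esum _ X).
have v0 x : (0 <= v x)%E by apply: integral_ge0 => y _; rewrite lee_fin.
have vfin x : (v x < +oo)%E.
  case: x => [[i j] [k l]]; rewrite /v/=.
  have := measure_matrix_poly (p^`(i) * q^`(j) * P i k * Q l j) k l hW.
  move=> /integrableP[_]; apply: le_lt_trans; rewrite le_eqVlt; apply/orP; left; apply/eqP.
  by apply: eq_integral => y _; rewrite !derive1n_horner /= !hornerM.
pose B := box (size p) (size q) (size p + ldo_deg a1) (size q + ldo_deg a2).
have vB x : x \notin B -> v x = 0%E.
  case: x => [[i j] [k l]]; rewrite mem_box/= => NB; rewrite /v/=.
  apply: integral0_eq => y _; rewrite !derive1n_horner/=.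
  have [ip|ip] := leqP (size p) i.
    by rewrite derivn_poly0// horner0 !mul0r normr0.
  have [jq|jq] := leqP (size q) j.
    by rewrite (@derivn_poly0 _ q)// horner0 mulr0 !mul0r normr0.
  have [kp|kp] := leqP (size p + ldo_deg a1) k.
    by rewrite (@ldo_pmx_upper _ a1) ?horner0 ?mulr0 ?mul0r ?normr0//; lia.
  have [lq|lq] := leqP (size q + ldo_deg a2) l.
    by rewrite (@ldo_pmx_tr_upper _ a2) ?horner0 ?mulr0 ?mul0r ?normr0//; lia.
  by rewrite ip jq kp lq in NB.
exact: esum_lty v0 vfin vB.
Qed.

Theorem sform_ldo_app_horner (p q : {poly R}) :
  sform W (ldo_app a1 (horner p)) (ldo_app a2 (horner q)) =
  sform LW (horner p) (horner q).
Proof.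
apply: (sform_ldo_app_summable hW openT) => //.
- by move=> n; exact: derivable_upto_horner.
- by move=> n; exact: derivable_upto_horner.
- exact: expanded_summable_horner.
Qed.

End polynomials.

Section gram_matrix.
Context {R : realType}.
Implicit Types (W : charge_matrix R) (p q : {poly R}) (a : ldo R).

Lemma derivn_monomials p n : p^`(n) = \sum_(k < size p) p`_k *: ('X^k)^`(n).
Proof.
by rewrite -[in LHS](coefK p) poly_def raddf_sum/=; under eq_bigr do rewrite derivnZ.
Qed.

Lemma sform_horner W p q (n m : nat) : (size p <= n)%N -> (size q <= m)%N ->
  sform W (horner p) (horner q) =
  \sum_(i < n) \sum_(j < m) term_integral W (horner p) (horner q) i j.
Proof.
move=> pn qm; apply: sform_finite => i j ij.
rewrite /term_integral -[RHS](cintegral_fun0 (W i j) (cm_dom W i j)).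
apply: eq_cintegral => x _; rewrite !derive1n_horner.
by case: ij => ij; [rewrite derivn_poly0|rewrite [in X in _ * X]derivn_poly0];
  rewrite ?horner0 ?mul0r ?mulr0//; lia.
Qed.

Lemma gramE W i j : gram W i j = sform W (horner 'X^i) (horner 'X^j).
Proof.
have E n : (fun x : R => x ^+ n) = horner 'X^n.
  by apply/funext => x; rewrite hornerXn.
by rewrite /gram !E.
Qed.

Lemma sform_gram W p q : is_measure_matrix W ->
  sform W (horner p) (horner q) =
  \sum_(k < size p) \sum_(l < size q) p`_k * q`_l * gram W k l.
Proof.
move=> hW; have [mW _ iW] := hW.
rewrite (sform_horner W (leqnn _) (leqnn _)).
transitivity (\sum_(i < size p) \sum_(j < size q) \sum_(k < size p) \sum_(l < size q)
    p`_k * q`_l * term_integral W (horner 'X^k) (horner 'X^l) i j).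
  apply: eq_bigr => i _; apply: eq_bigr => j _.
  pose F k l x : R := p`_k * q`_l * (derive1n i (horner 'X^k) x * derive1n j (horner 'X^l) x).
  have FZ k l := cintegralZ (p`_k * q`_l) (mW i j) (iW 'X^k 'X^l i j).
  have inner k := cintegral_sum (F := fun l => F k l) (index_enum 'I_(size q)) (mW i j)
    (fun l => (FZ k l).1).
  have [_ outer] := cintegral_sum (index_enum 'I_(size p)) (mW i j)
    (fun k : 'I_(size p) => (inner k).1).
  transitivity (\sum_(k < size p) cintegral (W i j) (cm_dom W i j)
      (fun x => \sum_(l < size q) F k l x)); last first.
    apply: eq_bigr => k _; rewrite (inner k).2; apply: eq_bigr => l _.
    exact: (FZ k l).2.
  rewrite -outer; apply: eq_cintegral => x _.
  rewrite !derive1n_horner [p^`(i)]derivn_monomials [q^`(j)]derivn_monomials.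
  rewrite !horner_sum mulr_suml; apply: eq_bigr => k _.
  rewrite mulr_sumr; apply: eq_bigr => l _.
  by rewrite /F !hornerZ !derive1n_horner; ring.
rewrite (exchange_sum4 _ _ _ _ (fun i j k l => p`_k * q`_l *
  term_integral W (horner 'X^k) (horner 'X^l) i j)).
apply: eq_bigr => k _; apply: eq_bigr => l _.
rewrite gramE (@sform_horner W 'X^k 'X^l (size p) (size q)) ?size_polyXn//.
by rewrite mulr_sumr; apply: eq_bigr => i _; rewrite mulr_sumr.
Qed.

(** The identity for polynomials, applied to monomials and expanded by
    bilinearity. *)
Theorem gram_pmx_mul W a1 a2 : is_measure_matrix W ->
  smx_mul (smx_mul (ldo_mx a1) (gram W)) (smx_tr (ldo_mx a2)) =
  gram (pmx_mul (ldo_pmx a1) W (smx_tr (ldo_pmx a2))).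
Proof.
move=> hW; apply/funext => i; apply/funext => j.
rewrite gramE -sform_ldo_app_horner// !ldo_app_horner sform_gram//.
rewrite {1}/smx_mul (@fsum_nat _ (size (ldo_poly a2 'X^j))); last first.
  by move=> l jl; rewrite /smx_tr -coef_ldo_polyXn nth_default// mulr0.
rewrite exchange_big/=; apply: eq_bigr => l _.
rewrite /smx_mul (@fsum_nat _ (size (ldo_poly a1 'X^i))); last first.
  by move=> k ik; rewrite -coef_ldo_polyXn nth_default// mul0r.
rewrite mulr_suml; apply: eq_bigr => k _.
by rewrite /smx_tr -!coef_ldo_polyXn; ring.
Qed.

End gram_matrix.

(** * Matrices of finite order *)

Section finite_order.
Context {R : realType}.
Local Notation T := (measurableTypeR R).
Variables (W : charge_matrix R) (hW : is_measure_matrix W) (a1 a2 : ldo R).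
Local Notation P := (ldo_pmx a1).
Local Notation Q := (smx_tr (ldo_pmx a2)).
Local Notation LW := (pmx_mul P W Q).

(** Convergence of the terms on both sides says nothing of the terms
    [pmx_term] of the expansion, which may diverge and cancel. They converge over
    the sets [A m] on which the products of derivatives of [f] and [h] are at
    most [m]; there the two sides agree, and [m] tends to infinity. *)
Theorem sform_ldo_app_finite_order (N : nat) (U : set R) (f h : R -> R) :
  has_order W N -> open U -> (forall i j, cm_dom W i j `<=` U) ->
  sform_defined U W N N (ldo_app a1 f) (ldo_app a2 h) ->
  sform_defined U LW (N + ldo_order a1) (N + ldo_order a2) f h ->
  sform W (ldo_app a1 f) (ldo_app a2 h) = sform LW f h.
Proof.
move=> WN oU WU [_ _ iL] [df dh iR]; have [mW _ _] := hW.
pose n1 := (N + ldo_order a1).+1; pose n2 := (N + ldo_order a2).+1.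
have mLW := measurable_pmx_mul_dom hW (@ldo_pmx_upper _ a1) (@ldo_pmx_tr_upper _ a2).
pose G i j x : R := derive1n i f x * derive1n j h x.
have mG i j : (i < n1)%N -> (j < n2)%N -> measurable_fun (cm_dom LW i j : set T) (G i j).
  by move=> i1 j2; apply/measurable_EFinP; apply: measurable_int (iR i j i1 j2).
(* The products of derivatives are extended by zero, as they are known to be
   measurable only on the sets carrying the entries of [P W Q]. *)
pose S x : R := \sum_(i < n1) \sum_(j < n2) `|((G i j) \_ (cm_dom LW i j)) x|.
pose A (m : nat) : set T := [set x | S x <= m%:R].
have mS : measurable_fun [set: T] S.
  apply: measurable_sum => i; apply: measurable_sum => j; apply: measurableT_comp => //.
  by apply/(measurable_restrictT _ (mLW i j)); exact: mG.
have mA m : measurable (A m).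
  rewrite (_ : A m = [set: T] `&` S @^-1` `]-oo, m%:R]).
    by apply: mS => //; exact: measurable_itv.
  by rewrite setTI; apply/seteqP; split => x /=; rewrite in_itv.
have Acov x : \forall m \near \oo, A m x by exact: nbhs_infty_ger.
have GA i j m x : (i < n1)%N -> (j < n2)%N -> cm_dom LW i j x -> A m x -> `|G i j x| <= m%:R.
  move=> i1 j2 Dx; apply: le_trans; rewrite /S.
  rewrite (bigD1 (Ordinal i1))//= (bigD1 (Ordinal j2))//= patchE mem_set//.
  by rewrite -addrA lerDl addr_ge0// sumr_ge0// => *; rewrite sumr_ge0.
have iT m i j k l : (i < n1)%N -> (j < n2)%N -> P i k != 0 -> Q l j != 0 ->
    cintegrable (W k l) (cm_dom W k l `&` A m) (pmx_summand a1 a2 f h i j k l).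
  move=> i1 j2 Pik Qlj; have sub : cm_dom W k l `<=` cm_dom LW i j.
    exact: pmx_mul_dom_sub.
  have mD := measurableI _ _ (mW k l) (mA m).
  have iPQ : cintegrable (W k l) (cm_dom W k l `&` A m) (horner (P i k * Q l j)).
    exact: cintegrableS (mW k l) mD (@subIsetl _ _ _) (measure_matrix_poly _ k l hW).
  apply: le_integrable (cintegralZ m%:R mD iPQ).1 => //.
    apply/measurable_EFinP/measurable_funM; last exact/measurable_EFinP/measurable_int/iPQ.
    by apply: measurable_funS (mG i j i1 j2) => // x [/sub].
  move=> x [/sub Dx Ax]; rewrite !abse_EFin lee_fin /pmx_summand !normrM.
  rewrite -normrM (ger0_norm (ler0n _ _)) ler_wpM2r//; exact: GA Dx Ax.
pose t m i j k l := pmx_term W a1 a2 (A m) f h i j k l.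
have tN m i j k l : (N < k)%N \/ (N < l)%N -> t m i j k l = 0.
  by move=> kl; apply: cintegral_null => B mB; exact: WN.
have lhs m k l : (k <= N)%N -> (l <= N)%N ->
    cintegral (W k l) (cm_dom W k l `&` A m)
      (fun x => derive1n k (ldo_app a1 f) x * derive1n l (ldo_app a2 h) x) =
    \sum_(i < n1) \sum_(j < n2) t m i j k l.
  move=> kN lN; apply: (cintegral_ldo_app hW oU (WU k l)) => //.
  - by move=> k' kk'; apply: df; lia.
  - by move=> k' kk'; apply: dh; lia.
  - by rewrite /n1; lia.
  - by rewrite /n2; lia.
  move=> i j; have [PQ0|] := eqVneq (P i k * Q l j) 0.
    by rewrite pmx_summand0//; exact: cintegrable_fun0.
  rewrite mulf_eq0 negb_or => /andP[Pik Qlj]; apply: iT => //.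
    rewrite ltnNge; apply: contra Pik => ik.
    by rewrite ldo_pmx_lower//; move: ik; rewrite /n1; lia.
  rewrite ltnNge; apply: contra Qlj => jl.
  by rewrite /smx_tr ldo_pmx_lower//; move: jl; rewrite /n2; lia.
have rhs m i j : (i < n1)%N -> (j < n2)%N ->
    cintegral (LW i j) (cm_dom LW i j `&` A m) (G i j) =
    \sum_(k < N.+1) \sum_(l < N.+1) t m i j k l.
  move=> i1 j2.
  rewrite (cintegral_pmx_mul hW (@ldo_pmx_upper _ a1) (@ldo_pmx_tr_upper _ a2)
    (n := (N + i + ldo_deg a1).+1) (m := (N + j + ldo_deg a2).+1) _ _ (mA m) _ _).2.
  - rewrite (@sum_ord_trunc _ N.+1 _ (fun k => \sum_(l < _) t m i j k l)); last 2 first.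
    + lia.
    + by move=> k Nk; rewrite big1// => l _; apply: tN; left.
    apply: eq_bigr => k _; apply: (@sum_ord_trunc _ _ _ (t m i j k)); first lia.
    by move=> l Nl; apply: tN; right.
  - lia.
  - lia.
  - by apply: measurable_funS (mG i j i1 j2) => // x [].
  - by move=> k l Pik Qlj; exact: iT.
have W0 g g' k l : (N < k)%N \/ (N < l)%N -> term_integral W g g' k l = 0.
  by move=> kl; apply: cintegral_null => B mB; exact: WN.
have LW0 i j : (n1 <= i)%N \/ (n2 <= j)%N -> term_integral LW f h i j = 0.
  move=> ij; apply: cintegral_null => B mB.
  apply: bigcadd_null => k; rewrite (mem_finite_support (fun k => @ldo_pmx_upper _ a1 i k)) => Pik.
  apply: bigcadd_null => l; rewrite (mem_finite_support (fun l => @ldo_pmx_tr_upper _ a2 l j)) => Qlj.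
  apply: cdensity_null => // C mC _; apply: WN => //.
  case: ij => [i1|j2]; [left|right]; rewrite ltnNge.
    by apply: contra Pik => kN; rewrite ldo_pmx_lower//; move: i1; rewrite /n1; lia.
  by apply: contra Qlj => lN; rewrite /smx_tr ldo_pmx_lower//; move: j2; rewrite /n2; lia.
rewrite (sform_finite (W0 _ _)) (sform_finite LW0).
have cvgL : (fun m => \sum_(k < N.+1) \sum_(l < N.+1)
    cintegral (W k l) (cm_dom W k l `&` A m)
      (fun x => derive1n k (ldo_app a1 f) x * derive1n l (ldo_app a2 h) x)) @ \oo -->
    \sum_(k < N.+1) \sum_(l < N.+1) term_integral W (ldo_app a1 f) (ldo_app a2 h) k l.
  apply: cvg_sumr => k; apply: cvg_sumr => l; apply: cintegral_exhaust => //.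
  by apply: iL; rewrite -ltnS.
have cvgR : (fun m => \sum_(i < n1) \sum_(j < n2)
    cintegral (LW i j) (cm_dom LW i j `&` A m) (G i j)) @ \oo -->
    \sum_(i < n1) \sum_(j < n2) term_integral LW f h i j.
  apply: cvg_sumr => i; apply: cvg_sumr => j; apply: cintegral_exhaust => //.
  by apply: iR; rewrite -ltnS.
rewrite -(cvg_lim (@Rhausdorff R) cvgL) -(cvg_lim (@Rhausdorff R) cvgR).
congr (limn _); apply/funext => m.
transitivity (\sum_(i < n1) \sum_(j < n2) \sum_(k < N.+1) \sum_(l < N.+1) t m i j k l).
  rewrite exchange_sum4; apply: eq_bigr => k _; apply: eq_bigr => l _.
  by rewrite lhs// -ltnS.
by apply: eq_bigr => i _; apply: eq_bigr => j _; rewrite rhs.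
Qed.

End finite_order.

(** * The theorem *)

Theorem proposition28 (R : realType) (W : charge_matrix R) (a1 a2 : ldo R)
    (hW : is_measure_matrix W) :
  let LW := pmx_mul (ldo_pmx a1) W (smx_tr (ldo_pmx a2)) in
  [/\ is_measure_matrix LW,
      (* polynomials *)
      forall p q : {poly R},
        sform W (ldo_app a1 (horner p)) (ldo_app a2 (horner q)) =
        sform LW (horner p) (horner q),
      (* functions, finite order *)
      forall (N : nat) (U : set R) (f h : R -> R),
        has_order W N -> open U -> (forall i j, cm_dom W i j `<=` U) ->
        sform_defined U W N N (ldo_app a1 f) (ldo_app a2 h) ->
        sform_defined U LW (N + ldo_order a1) (N + ldo_order a2) f h ->
        sform W (ldo_app a1 f) (ldo_app a2 h) = sform LW f h,
      (* functions, infinite order *)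
      forall (U : set R) (f h : R -> R),
        open U -> (forall i j, cm_dom W i j `<=` U) ->
        (forall n, derivable_upto U n f) -> (forall n, derivable_upto U n h) ->
        expanded_summable (ldo_pmx a1) W (smx_tr (ldo_pmx a2)) f h ->
        sform W (ldo_app a1 f) (ldo_app a2 h) = sform LW f h
    & smx_mul (smx_mul (ldo_mx a1) (gram W)) (smx_tr (ldo_mx a2)) = gram LW].
Proof.
move=> LW; split.
- exact: is_measure_matrix_pmx_mul.
- by move=> p q; exact: sform_ldo_app_horner.
- by move=> N U f h; exact: sform_ldo_app_finite_order.
- by move=> U f h; exact: sform_ldo_app_summable.
- exact: gram_pmx_mul.
Qed.
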